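(* Let $D$ be a division ring with center $F$, where $F$ contains at least four elements, let $n$ be a positive integer, and let $\star$ be an involution of the first kind on $A:=\mathrm{M}_n(D)$. If $G$ is a non-central subnormal subgroup of $\mathrm{GL}_n(D)$, then the following assertions are equivalent: (1) $T_G\subseteq F$; (2) $T_A\subseteq F$; (3) $N_A\subseteq F$; (4) $N_G\subseteq F$. Moreover, if one of these conditions holds, then either (i) $n=1$ and $D$ is a quaternion division algebra over $F$, or (ii) $n=2$, $D=F$ and $\star$ is the ordinary symplectic involution on $\mathrm{M}_2(F)$.
   Context: Rings are associative with identity $1\neq 0$. An involution on a ring $A$ is a map $\star:A\to A$ with $(x+y)^\star=x^\star+y^\star$, $(xy)^\star=y^\star x^\star$ and $(x^\star)^\star=x$ for all $x,y\in A$. It is of the first kind if $z^\star=z$ for every $z$ in the center $Z(A)$. The center of $\mathrm{M}_n(D)$ is identified with $F$ (scalar matrices with entries in $F$). For a subset $X\subseteq A$ (in particular $X=A$ or $X=G$), $T_X=\{x+x^\star\mid x\in X\}$ and $N_X=\{xx^\star\mid x\in X\}$. $A^\times$ is the multiplicative group of $A$; $\mathrm{GL}_n(D)=\mathrm{M}_n(D)^\times$. A subset of $A$ is central if it is contained in $Z(A)$. A quaternion division algebra over $F$ is a division ring with center $F$ and of dimension $4$ over $F$. The ordinary symplectic involution on $\mathrm{M}_2(F)$ is $\begin{pmatrix} a & b\\ c& d\end{pmatrix}^\star=\begin{pmatrix} d & -b\\ -c& a\end{pmatrix}$. *)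

(* Defs.v *)
From mathcomp Require Import all_boot all_order all_algebra.
From mathcomp Require Import boolp classical_sets.

Set Implicit Arguments.
Unset Strict Implicit.
Unset Printing Implicit Defensive.

Import GRing.Theory.

Local Open Scope classical_set_scope.
Local Open Scope ring_scope.

(* Matrices over a noncommutative ring carry no unitRingType instance in
   MathComp, and 'M_n is only a pzRingType for a variable n; hence the
   vocabulary below is set up for an arbitrary pzRingType. *)
Section Rings.
Variable A : pzRingType.

Definition center : set A := [set z | forall x, z * x = x * z].

Definition inverses (x y : A) : Prop := x * y = 1 /\ y * x = 1.

Definition unit_group : set A := [set x | exists y, inverses x y].

Definition is_subgroup (H : set A) : Prop :=
  [/\ H `<=` unit_group,
      H 1,
      forall x y, H x -> H y -> H (x * y)
    & forall x y, H x -> inverses x y -> H y].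

Definition is_normal (H K : set A) : Prop :=
  H `<=` K /\ forall k k' h, K k -> inverses k k' -> H h -> H (k * h * k').

Definition is_subnormal (G K : set A) : Prop :=
  exists (r : nat) (chain : nat -> set A),
    [/\ chain 0%N = G, chain r = K,
        forall i, (i <= r)%N -> is_subgroup (chain i)
      & forall i, (i < r)%N -> is_normal (chain i) (chain i.+1)].

Definition is_involution (star : A -> A) : Prop :=
  [/\ forall x y, star (x + y) = star x + star y,
      forall x y, star (x * y) = star y * star x
    & forall x, star (star x) = x].

Definition first_kind (star : A -> A) : Prop :=
  forall z, center z -> star z = z.

Definition traces (star : A -> A) (X : set A) : set A :=
  [set x + star x | x in X].

Definition norms (star : A -> A) (X : set A) : set A :=
  [set x * star x | x in X].

End Rings.

Arguments center : clear implicits.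
Arguments unit_group : clear implicits.

(* The center is presented as a field F acting on D, a |-> a%:A being
   injective since D is nonzero. *)
Definition division_ring_with_center (F : fieldType) (D : unitAlgType F) :
    Prop :=
  (forall x : D, x != 0 -> x \is a GRing.unit) /\
  center D = range (fun a : F => a%:A : D).

Definition has_dimension (F : fieldType) (V : lmodType F) (d : nat) : Prop :=
  exists2 f : V -> 'rV[F]_d, linear f & bijective f.

Definition quaternion_division_algebra (F : fieldType) (D : unitAlgType F) :
    Prop :=
  division_ring_with_center D /\ has_dimension D 4.

Definition scalar_matrices (F : fieldType) (D : unitAlgType F) (n : nat) :
    set 'M[D]_n :=
  range (fun a : F => (a%:A : D)%:M).

Arguments scalar_matrices {F} D n.

(* The map sending the rows (a, b), (c, d) to (d, -b), (-c, a); on 'I_2,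
   rev_ord exchanges the two indices. *)
Definition symplectic2 (R : pzRingType) (x : 'M[R]_2) : 'M[R]_2 :=
  \matrix_(i, j) if i == j then x (rev_ord i) (rev_ord j) else - x i j.

(* [n] is a variable, so the equation n = 2 is used to transport matrices. *)
Definition is_ordinary_symplectic (R : pzRingType) (n : nat)
    (star : 'M[R]_n -> 'M[R]_n) : Prop :=
  exists e : n = 2%N,
    forall x, castmx (e, e) (star x) = symplectic2 (castmx (e, e) x).

(* Main.v *)
From HB Require Import structures.
Require Import Defs.
From mathcomp Require Import all_boot all_order all_algebra all_field.
From mathcomp Require Import boolp classical_sets cardinality zify.

Set Implicit Arguments.
Unset Strict Implicit.
Unset Printing Implicit Defensive.

Import GRing.Theory.

Local Open Scope classical_set_scope.
Local Open Scope ring_scope.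

(** A noncentral subnormal subgroup [G] of [GL_n(D)] is large enough to see the
whole involution.  The reasons are different for [n >= 2] and for [n = 1].

Let [n >= 2].  A noncentral subgroup that is normalized by all transvections
[1 + a e_ij] contains all of them: this is Iwasawa's argument, [transv_in], and
it uses a scalar [c] of [F] with [c <> 0] and [c^2 <> 1].  Going down a
subnormal chain, [G] contains every [1 + a e_ij] ([subnormal_transv]).  If
their traces are scalar, or their norms for all [a], then
[a e_ij + star (a e_ij)] is scalar, and squaring shows that it is [0].  Hence
[star (ab e_ii) = star (a e_ij * b e_ji) = ba e_jj] for all [j <> i], so that
[n = 2], [D] is commutative and [star] is symplectic; then [x + star x] and
[x * star x] are the trace and the determinant of [x].

Let [n = 1].  Everything rests on [subnormal_centralizer]: an element that
commutes with [G] is central; [subnormal_centralizer_mod] says the same of an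
element that commutes with [G] modulo the center.  Suppose that the norms of
[G] are central and that [x] normalizes [G].  Comparing the norms of [g] and
of [x g x^-1] shows that [star x * x] commutes with [G] modulo the center, so
it is central.  Thus central norms climb the subnormal chain up to [D]
([norms_subnormal]), and the norm of [1 + x] then gives the trace of [x].  If
the traces of [G] are central, so are its norms: compare the traces of [x] and
[x^-1], and if they vanish show that [x^2] commutes with [G]
([traces_norms_subnormal]).  Finally, if all traces and norms are central and
[star u <> u], then [D] is a plane over [F(u)] ([trace_norm_quaternion]).

The proof of [subnormal_centralizer] is an induction on the depth [r] of [G].
The iterated commutator [[..[[x, g_1], g_2].., g_r]] of a unit [x] with
elements of [G] belongs to [G].  Put [x = 1 + y t], where [t] runs through
sufficiently many elements that commute with everything in sight.  A condition
on these commutators becomes an identity between Ore fractions in [t], and its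
part of degree one is the linear condition
[(1 - Ad g_r) .. (1 - Ad g_1) y = 0] ([linear_principle]).  When the center is
infinite [t] may run through it, but the center may be finite; then the
parameter is a transcendental element of a centralizer, which exists by an
argument of Jacobson, or an infinite fixed field, or the polynomials are
replaced by skew polynomials in a normalizing element.

Let [K] be the centralizer of [G], [K'] the centralizer of [K], and let [G] be
normal in [H], where [H] has smaller depth.  If [K] meets [K'] outside the
center, the intersection is a commutative field normalized but not centralized
by [H], which is impossible by [no_normalized_field].  Otherwise, if [K] is not
central, then [1 - Ad g] is nilpotent on [K'] for every [g] in [G]
([iter_delta_double_centralizer]).  In both cases the contradiction comes from
unipotency: if [1 - Ad g] is nilpotent and not zero, then the characteristic is
a prime [p] and [g y g^-1 = y + 1] for some [y] ([unipotent_shift]), whereas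
the iterated commutators of this [y] with [g] never become [1]
([gcomm_shift_neq1]). *)

(** * Conjugation, commutators and division subrings *)

Section Conjugation.
Variable D : unitRingType.
Hypothesis hdiv : forall x : D, x != 0 -> x \is a GRing.unit.
Implicit Types (x y z g h : D) (gs : seq D).

Lemma div_mulf_neq0 x y : x != 0 -> y != 0 -> x * y != 0.
Proof.
move=> x0 y0; suff: x * y \is a GRing.unit.
  by apply: contraTneq => ->; rewrite unitr0.
by rewrite unitrMl ?hdiv.
Qed.

Lemma div_invr_neq0 x : x != 0 -> x^-1 != 0.
Proof.
move=> x0; suff: x^-1 \is a GRing.unit by apply: contraTneq => ->; rewrite unitr0.
by rewrite unitrV hdiv.
Qed.

Lemma div_mulf_eq0 x y : x * y = 0 -> x = 0 \/ y = 0.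
Proof.
move=> xy0; have [->|x0] := eqVneq x 0; first by left.
have [->|y0] := eqVneq y 0; first by right.
by have := div_mulf_neq0 x0 y0; rewrite xy0 eqxx.
Qed.

Lemma div_expf_neq0 x n : x != 0 -> x ^+ n != 0.
Proof.
by move=> x0; elim: n => [|n IH]; rewrite ?oner_neq0 // exprS div_mulf_neq0.
Qed.

Lemma div_mulIf x y z : z != 0 -> x * z = y * z -> x = y.
Proof. by move=> z0; apply: mulIr; apply: hdiv. Qed.

Lemma div_mulfI x y z : z != 0 -> z * x = z * y -> x = y.
Proof. by move=> z0; apply: mulrI; apply: hdiv. Qed.

Definition cj g x := g * x * g^-1.
(** This is the group commutator [x g x^-1 g^-1], written as a product of [x]
and of a conjugate of [x^-1] so that it makes sense as a fraction in [x]. *)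
Definition gcomm g x := x * (cj g x)^-1.
(** This is [(1 - Ad g) x], the derivative of [gcomm g] at [1] in the direction [x]. *)
Definition delta g x := x - cj g x.
Definition gcomms x gs := foldl (fun y g => gcomm g y) x gs.
Definition deltas x gs := foldl (fun y g => delta g y) x gs.

Lemma cj0 g : cj g 0 = 0. Proof. by rewrite /cj mulr0 mul0r. Qed.
Lemma cjD g x y : cj g (x + y) = cj g x + cj g y.
Proof. by rewrite /cj mulrDr mulrDl. Qed.
Lemma cjN g x : cj g (- x) = - cj g x.
Proof. by rewrite /cj mulrN mulNr. Qed.
Lemma cjB g x y : cj g (x - y) = cj g x - cj g y.
Proof. by rewrite cjD cjN. Qed.
Lemma cj1 g : g != 0 -> cj g 1 = 1.
Proof. by move=> g0; rewrite /cj mulr1 divrr ?hdiv. Qed.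
Lemma cjM g x y : g != 0 -> cj g (x * y) = cj g x * cj g y.
Proof. by move=> g0; rewrite /cj !mulrA mulrVK ?hdiv. Qed.
Lemma cj_neq0 g x : g != 0 -> x != 0 -> cj g x != 0.
Proof. by move=> g0 x0; rewrite !div_mulf_neq0 ?div_invr_neq0. Qed.
Lemma cjV g x : g != 0 -> cj g x^-1 = (cj g x)^-1.
Proof.
move=> g0; have [->|x0] := eqVneq x 0; first by rewrite invr0 cj0 invr0.
apply: (@div_mulIf _ _ (cj g x)); first exact: cj_neq0.
by rewrite -cjM // mulVr ?hdiv // cj1 // mulVr ?hdiv // cj_neq0.
Qed.
Lemma cjX g x n : g != 0 -> cj g (x ^+ n) = cj g x ^+ n.
Proof. by move=> g0; elim: n => [|n IH]; rewrite ?cj1 // !exprS cjM // IH. Qed.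
Lemma cj_cj g h x : g != 0 -> h != 0 -> cj g (cj h x) = cj (g * h) x.
Proof. by move=> g0 h0; rewrite /cj invrM ?hdiv // !mulrA. Qed.
Lemma cj1l x : cj 1 x = x. Proof. by rewrite /cj invr1 mul1r mulr1. Qed.
Lemma cjK g x : g != 0 -> cj g^-1 (cj g x) = x.
Proof. by move=> g0; rewrite cj_cj ?div_invr_neq0 // mulVr ?hdiv // cj1l. Qed.
Lemma cjVK g x : g != 0 -> cj g (cj g^-1 x) = x.
Proof. by move=> g0; rewrite cj_cj ?div_invr_neq0 // divrr ?hdiv // cj1l. Qed.
Lemma cj_mulr g x : g != 0 -> cj g x * g = g * x.
Proof. by move=> g0; rewrite /cj mulrVK ?hdiv. Qed.
Lemma cj_fixE g x : g != 0 -> cj g x = x -> g * x = x * g.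
Proof. by move=> g0 E; rewrite -{2}E cj_mulr. Qed.
Lemma cj_fix g x : g != 0 -> g * x = x * g -> cj g x = x.
Proof. by move=> g0 E; rewrite /cj E mulrK ?hdiv. Qed.
Lemma cj_comm g x y : g != 0 -> x * y = y * x -> cj g x * cj g y = cj g y * cj g x.
Proof. by move=> g0 E; rewrite -!cjM // E. Qed.

Lemma gcomm_neq0 g x : g != 0 -> x != 0 -> gcomm g x != 0.
Proof. by move=> g0 x0; rewrite div_mulf_neq0 ?div_invr_neq0 ?cj_neq0. Qed.
Lemma gcommE g x : g != 0 -> x != 0 -> gcomm g x = x * g * x^-1 * g^-1.
Proof. by move=> g0 x0; rewrite /gcomm -cjV // /cj !mulrA. Qed.
Lemma gcomm_eq1 g x : g != 0 -> x != 0 -> gcomm g x = 1 -> g * x = x * g.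
Proof.
move=> g0 x0 E; apply: cj_fixE => //.
have /(congr1 ( *%R^~ (cj g x))) := E.
by rewrite mul1r /gcomm mulrVK ?hdiv ?cj_neq0.
Qed.
Lemma gcomm_id g x : g != 0 -> x != 0 -> g * x = x * g -> gcomm g x = 1.
Proof. by move=> g0 x0 E; rewrite /gcomm cj_fix // divrr ?hdiv. Qed.
Lemma delta0 g : delta g 0 = 0.
Proof. by rewrite /delta cj0 subrr. Qed.
Lemma delta_eq0 g x : g != 0 -> delta g x = 0 -> g * x = x * g.
Proof. by move=> g0 /eqP; rewrite subr_eq0 => /eqP E; apply: cj_fixE. Qed.

Definition divsubring (K : set D) :=
  [/\ K 1, forall x y, K x -> K y -> K (x - y),
      forall x y, K x -> K y -> K (x * y) & forall x, K x -> K x^-1].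

Section DivSub.
Variable (K : set D) (hK : divsubring K).
Lemma ds1 : K 1. Proof. by case: hK. Qed.
Lemma dsB x y : K x -> K y -> K (x - y). Proof. by case: hK => _ + _ _; apply. Qed.
Lemma dsM x y : K x -> K y -> K (x * y). Proof. by case: hK => _ _ + _; apply. Qed.
Lemma dsV x : K x -> K x^-1. Proof. by case: hK => _ _ _; apply. Qed.
Lemma ds0 : K 0. Proof. by rewrite -(subrr 1); apply: dsB; apply: ds1. Qed.
Lemma dsN x : K x -> K (- x). Proof. by move=> kx; rewrite -sub0r; apply: dsB => //; apply: ds0. Qed.
Lemma dsD x y : K x -> K y -> K (x + y).
Proof. by move=> kx ky; rewrite -[y]opprK; apply: dsB => //; apply: dsN. Qed.
Lemma dsX x n : K x -> K (x ^+ n).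
Proof. by move=> kx; elim: n => [|n IH]; [apply: ds1 | rewrite exprS; apply: dsM]. Qed.
Lemma ds_sum n (f : 'I_n -> D) : (forall i, K (f i)) -> K (\sum_i f i).
Proof. by move=> H; apply: big_ind => //; [apply: ds0 | apply: dsD]. Qed.
Lemma ds_cj g x : K g -> K x -> K (cj g x).
Proof. by move=> kg kx; apply: dsM; [apply: dsM | apply: dsV]. Qed.
Lemma ds_gcomm g x : K x -> K (cj g x) -> K (gcomm g x).
Proof. by move=> kx kc; apply: dsM => //; apply: dsV. Qed.
Lemma ds_delta g x : K x -> K (cj g x) -> K (delta g x).
Proof. exact: dsB. Qed.
End DivSub.

Definition centralizer (X : set D) : set D := [set x | forall y, X y -> x * y = y * x].

Lemma centralizer_divsubring X : divsubring (centralizer X).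
Proof.
split=> [y _ | x y hx hy z hz | x y hx hy z hz | x hx z hz].
- by rewrite mulr1 mul1r.
- by rewrite mulrBl mulrBr hx // hy.
- by rewrite -mulrA hy // mulrA hx // mulrA.
have [->|x0] := eqVneq x 0; first by rewrite invr0 mulr0 mul0r.
apply: (@div_mulIf _ _ x) => //.
by rewrite mulrVK ?hdiv // -mulrA -hx // mulKr ?hdiv.
Qed.

Lemma centralizer_cj X g x : g != 0 -> (forall y, X y -> X (cj g^-1 y)) ->
  centralizer X x -> centralizer X (cj g x).
Proof.
move=> g0 H hx y hy.
by rewrite -[y](cjVK _ g0) cj_comm // hx //; apply: H.
Qed.

Lemma centerE : center D = centralizer setT.
Proof. by apply/seteqP; split=> x hx y; [move=> _; apply: hx | apply: hx]. Qed.

Lemma center_divsubring : divsubring (center D).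
Proof. by rewrite centerE; apply: centralizer_divsubring. Qed.

End Conjugation.

(** * Ore fractions and the linear principle *)

Section Graded.
Variable D : unitRingType.
Hypothesis hdiv : forall x : D, x != 0 -> x \is a GRing.unit.
Implicit Types (x y z g h : D) (gs : seq D) (P Q R W : {poly D}).

(** These are the homogeneous components of a graded ring in which nonzero
homogeneous elements are invertible, placed inside [D].  The two examples below
are [K, K, ..] and [L, L h, L h^2, ..]; the second makes polynomials with the
[i]-th coefficient in [L h^i] a copy of the skew polynomials over [L]. *)
Record graded_division (V : nat -> set D) (v : D) : Prop := GradedDivision {
  gd_sub : forall i x y, V i x -> V i y -> V i (x - y);
  gd_mul : forall i j x y, V i x -> V j y -> V (i + j)%N (x * y);
  gd_ldiv : forall i j x y, V i x -> x != 0 -> V (i + j)%N y -> V j (x^-1 * y);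
  gd_rdiv : forall i j x y, V i x -> x != 0 -> V (j + i)%N y -> V j (y * x^-1);
  gd_one : V 0%N 1;
  gd_degree1 : V 1%N v;
  gd_degree1_neq0 : v != 0 }.

Variables (V : nat -> set D) (v : D).
Hypothesis hV : graded_division V v.

Lemma gd_zero i : V i 0.
Proof.
have : exists x, V i x.
  elim: i => [|i [x hx]]; first by exists 1; apply: gd_one hV.
  by exists (x * v); rewrite -addn1; apply: (gd_mul hV) => //; apply: gd_degree1 hV.
by case=> x hx; rewrite -(subrr x); apply: (gd_sub hV).
Qed.
Lemma gd_opp i x : V i x -> V i (- x).
Proof. by move=> hx; rewrite -sub0r; apply: (gd_sub hV) => //; apply: gd_zero. Qed.
Lemma gd_add i x y : V i x -> V i y -> V i (x + y).
Proof. by move=> hx hy; rewrite -[y]opprK; apply: (gd_sub hV) => //; apply: gd_opp. Qed.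

Definition homog P := forall i, V i P`_i.

Lemma homogB P Q : homog P -> homog Q -> homog (P - Q).
Proof. by move=> hP hQ i; rewrite coefB; apply: (gd_sub hV). Qed.
Lemma homog0 : homog 0.
Proof. by move=> i; rewrite coef0; apply: gd_zero. Qed.
Lemma homogD P Q : homog P -> homog Q -> homog (P + Q).
Proof. by move=> hP hQ i; rewrite coefD; apply: gd_add. Qed.
Lemma homogM P Q : homog P -> homog Q -> homog (P * Q).
Proof.
move=> hP hQ i; rewrite coefM; apply: big_ind => [||j _]; [exact: gd_zero|exact: gd_add|].
by have := gd_mul hV (hP j) (hQ (i - j)%N); rewrite subnKC // -ltnS.
Qed.
Lemma homogC c : V 0%N c -> homog c%:P.
Proof. by move=> hc i; rewrite coefC; case: eqP => [->|_] //; apply: gd_zero. Qed.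
Lemma homog1 : homog 1. Proof. by apply: homogC; apply: gd_one hV. Qed.
Lemma homogCXn c n : V n c -> homog (c%:P * 'X^n).
Proof.
move=> hc i; rewrite coefCM coefXn; case: eqP => [->|_]; rewrite ?mulr1 ?mulr0 //.
exact: gd_zero.
Qed.

Lemma polyD_mul_neq0 P Q : P != 0 -> Q != 0 -> P * Q != 0.
Proof.
by move=> P0 Q0; rewrite -lead_coef_eq0 lead_coef_proper_mul ?div_mulf_neq0 ?lead_coef_eq0.
Qed.

Lemma size_polyMC P c : c != 0 -> size (P * c%:P) = size P.
Proof.
move=> c0; have [->|P0] := eqVneq P 0; first by rewrite mul0r.
rewrite size_proper_mul ?lead_coefC; first by rewrite size_polyC c0 addn1.
by rewrite div_mulf_neq0 ?lead_coef_eq0.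
Qed.

Lemma homog_reduce P Q : homog P -> homog Q -> Q != 0 -> (size Q <= size P)%N ->
  P != 0 -> exists2 S, homog S & (size (P - Q * S)%R < size P)%N.
Proof.
move=> hP hQ Q0 sz P0; pose k := (size P - size Q)%N.
pose c := (lead_coef Q)^-1 * lead_coef P.
have lQ0 : lead_coef Q != 0 by rewrite lead_coef_eq0.
have lP0 : lead_coef P != 0 by rewrite lead_coef_eq0.
have Qpos : (0 < size Q)%N by rewrite size_poly_gt0.
have c0 : c != 0 by rewrite div_mulf_neq0 ?div_invr_neq0.
have hS : homog (c%:P * 'X^k).
  apply: homogCXn; apply: (gd_ldiv hV (i := (size Q).-1) (j := k) (x := lead_coef Q)) => //.
  have -> : ((size Q).-1 + k)%N = (size P).-1 by rewrite /k; lia.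
  by rewrite lead_coefE; apply: hP.
exists (c%:P * 'X^k) => //; rewrite mulrA.
have szS : size (Q * c%:P * 'X^k) = size P.
  rewrite size_mulXn; last by rewrite polyD_mul_neq0 // polyC_eq0.
  by rewrite size_polyMC //; move: sz; rewrite /k; lia.
rewrite -[X in (_ < X)%N](prednK (n := size P)) ?size_poly_gt0 // ltnS.
apply/leq_sizeP => j; rewrite leq_eqVlt => /orP[/eqP <-|lt]; last first.
  have lj : (size P <= j)%N by rewrite -(prednK (n := size P)) ?size_poly_gt0.
  by rewrite coefB !nth_default ?subrr // szS.
rewrite coefB coefMXn; have -> : ((size P).-1 < k)%N = false by rewrite /k; lia.
  have -> : ((size P).-1 - k = (size Q).-1)%N by rewrite /k; lia.
  by rewrite coefMC -!lead_coefE /c mulVKr ?hdiv // subrr.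
Qed.

(** Euclid's algorithm on the pair [(P, Q)] produces a common right multiple,
as it does for skew polynomials. *)
Lemma ore_exists P Q : homog P -> homog Q -> Q != 0 ->
  exists P' Q', [/\ homog P', homog Q', Q' != 0 & P * Q' = Q * P'].
Proof.
have [n] := ubnP (size P + size Q)%N; elim: n P Q => // n IH P Q lt hP hQ Q0.
have [->|P0] := eqVneq P 0.
  exists 0, 1; rewrite mul0r mulr0; split=> //; last exact: oner_neq0.
    exact: homog0.
  exact: homog1.
have [le|gt] := leqP (size Q) (size P).
  have [S hS ltS] := homog_reduce hP hQ Q0 le P0.
  have [|P' [Q' [hP' hQ' Q'0 E]]] := IH (P - Q * S) Q _ (homogB hP (homogM hQ hS)) hQ Q0.
    by move: lt ltS; lia.
  exists (P' + S * Q'), Q'; split=> //; first by apply: homogD => //; apply: homogM.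
  by rewrite mulrDr -E mulrBl mulrA subrK.
have [S hS ltS] := homog_reduce hQ hP P0 (ltnW gt) Q0.
have [Q1|Q1] := eqVneq (Q - P * S) 0.
  exists 1, S; move/eqP: Q1; rewrite subr_eq0 => /eqP EQ; split=> //.
  - exact: homog1.
  - by apply: contraNneq Q0 => S0; rewrite EQ S0 mulr0.
  - by rewrite mulr1.
have [|P' [Q' [hP' hQ' Q'0 E]]] := IH P (Q - P * S) _ hP (homogB hQ (homogM hP hS)) Q1.
  by move: lt ltS; lia.
have E2 : P * (Q' + S * P') = Q * P' by rewrite mulrDr E mulrBl mulrA subrK.
exists P', (Q' + S * P'); split=> //; first by apply: homogD => //; apply: homogM.
apply/eqP => Z; have P'0 : P' = 0.
  by apply/eqP/contraT => P'0; have := polyD_mul_neq0 Q0 P'0; rewrite -E2 Z mulr0 eqxx.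
by have := polyD_mul_neq0 P0 Q'0; rewrite E P'0 mulr0 eqxx.
Qed.

Lemma coef1M P Q : (P * Q)`_1 = P`_0 * Q`_1 + P`_1 * Q`_0.
Proof. by rewrite coefM big_ord_recl big_ord1. Qed.

(** Fractions defined at [0] have to be multiplied without losing their value
and derivative at [0].  If the cofactors of [ore_exists] vanish at [0], both
can be divided by the central variable; this shifts degrees, and dividing by an
element of degree one as well restores them. *)
Lemma ore_normalized P Q : homog P -> homog Q -> P`_0 = 1 -> Q`_0 = 1 ->
  exists P' Q', [/\ homog P', homog Q', P'`_0 = 1, Q'`_0 = 1 & P * Q' = Q * P'].
Proof.
move=> hP hQ P01 Q01.
have Q0 : Q != 0 by apply: contraTneq isT => Q0; move/eqP: Q01; rewrite Q0 coef0 eq_sym oner_eq0.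
have [P' [Q' [hP' hQ' Q'0 E]]] := ore_exists hP hQ Q0.
have [n] := ubnP (size Q'); elim: n P' Q' hP' hQ' Q'0 E => // n IH P' Q' hP' hQ' Q'0 E lt.
have E0 : P'`_0 = Q'`_0.
  by have /(congr1 (fun p : {poly D} => p`_0)) := E; rewrite !coef0M P01 Q01 !mul1r.
have [c0|c0] := eqVneq Q'`_0 0; last first.
  have hc : V 0%N (Q'`_0)^-1.
    by rewrite -[_^-1]mulr1; apply: (gd_ldiv hV (i := 0%N)) => //; apply: gd_one hV.
  exists (P' * (Q'`_0)^-1%:P), (Q' * (Q'`_0)^-1%:P); split.
  - by apply: homogM => //; apply: homogC.
  - by apply: homogM => //; apply: homogC.
  - by rewrite coefMC E0 divrr ?hdiv.
  - by rewrite coefMC divrr ?hdiv.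
  - by rewrite !mulrA E.
have shiftE (A : {poly D}) : A`_0 = 0 -> A = drop_poly 1 A * 'X.
  move=> A0; apply/polyP => i; rewrite coefMX coef_drop_poly addn1.
  by case: i.
have hdrop (A : {poly D}) : homog A -> homog (drop_poly 1 A * v^-1%:P).
  move=> hA i; rewrite coefMC coef_drop_poly.
  by apply: (gd_rdiv hV (gd_degree1 hV) (gd_degree1_neq0 hV)).
have v0 := gd_degree1_neq0 hV.
have vi0 : v^-1%:P != 0 :> {poly D} by rewrite polyC_eq0 div_invr_neq0.
have d0 : drop_poly 1 Q' != 0.
  by apply: contraNneq Q'0 => d0; rewrite (shiftE Q') // d0 mul0r.
apply: (IH (drop_poly 1 P' * v^-1%:P) (drop_poly 1 Q' * v^-1%:P)).
- exact: hdrop.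
- exact: hdrop.
- exact: polyD_mul_neq0.
- rewrite !mulrA; congr (_ * _).
  apply/polyP => i; have /(congr1 (fun p : {poly D} => p`_i.+1)) := E.
  by rewrite {1}(shiftE Q') // {1}(shiftE P') ?E0 // !mulrA !coefMX.
rewrite size_polyMC ?div_invr_neq0 // size_drop_poly.
by move: lt Q'0; rewrite -size_poly_gt0; lia.
Qed.

(** The variable is evaluated at the points of [T]; they commute with all
coefficients, and no nonzero homogeneous polynomial vanishes on all of [T]. *)
Variable T : set D.
Hypothesis T_comm : forall t i x, T t -> V i x -> t * x = x * t.
Hypothesis T_sep : forall R, homog R -> R != 0 -> exists2 t, T t & R.[t] != 0.

Lemma homog_hornerM P Q t : homog Q -> T t -> (P * Q).[t] = P.[t] * Q.[t].
Proof.
move=> hQ ht; apply: hornerM_comm; apply: comm_coef_poly => i.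
by rewrite /GRing.comm (T_comm ht (hQ i)).
Qed.

(** [f] is given on [T] by a right fraction [P / Q] that has value [1] and
derivative [k] at [0].  The polynomial [W] collects the points to be avoided,
where a denominator vanishes. *)
Definition fraction (f : D -> D) k := exists P Q W,
  [/\ [/\ homog P, homog Q & homog W], P`_0 = 1 /\ Q`_0 = 1, k = P`_1 - Q`_1, W != 0 &
      forall t, T t -> W.[t] != 0 -> [/\ Q.[t] != 0, P.[t] != 0 & f t * Q.[t] = P.[t]]].

Lemma fractionM f1 f2 k1 k2 : fraction f1 k1 -> fraction f2 k2 ->
  fraction (fun t => f1 t * f2 t) (k1 + k2).
Proof.
move=> [P [Q [W [[hP hQ hW] [P0 Q0] -> W0 H]]]] [R [S [X [[hR hS hX] [R0 S0] -> X0 H']]]].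
have [R' [Q' [hR' hQ' R'0 Q'0 E]]] := ore_normalized hR hQ R0 Q0.
have Q'n0 : Q' != 0 by apply: contraTneq isT => Z; move/eqP: Q'0; rewrite Z coef0 eq_sym oner_eq0.
exists (P * R'), (S * Q'), (W * X * Q'); split.
- by split; do ?apply: homogM.
- by rewrite !coef0M P0 R'0 S0 Q'0 !mulr1.
- have /(congr1 (fun p : {poly D} => p`_1)) := E.
  rewrite !coef1M R0 Q'0 Q0 R'0 P0 S0 !mul1r !mulr1 => E1.
  have -> : R`_1 = R'`_1 + Q`_1 - Q'`_1 by rewrite -E1 addrC addKr.
  by rewrite opprD -!addrA [- Q`_1 + _]addrCA addKr addrCA.
- by rewrite !polyD_mul_neq0.
move=> t ht; rewrite !homog_hornerM //; do ?apply: homogM => //; move=> nz.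
have [W1 X1 Q1] : [/\ W.[t] != 0, X.[t] != 0 & Q'.[t] != 0].
  split; apply: contraNneq nz => ->; by rewrite ?mulr0 ?mul0r.
have [a1 a2 a3] := H t ht W1; have [b1 b2 b3] := H' t ht X1.
have Et : R.[t] * Q'.[t] = Q.[t] * R'.[t] by rewrite -!homog_hornerM // E.
split; [exact: div_mulf_neq0 | | ].
  apply: div_mulf_neq0 => //; apply/eqP => Z.
  by have := div_mulf_neq0 hdiv b2 Q1; rewrite Et Z mulr0 eqxx.
by rewrite -mulrA (mulrA (f2 t)) b3 Et mulrA a3.
Qed.

Lemma fractionV f k : fraction f k -> fraction (fun t => (f t)^-1) (- k).
Proof.
move=> [P [Q [W [[hP hQ hW] [P0 Q0] -> W0 H]]]].
exists Q, P, W; split=> //; first by rewrite opprB.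
move=> t ht /(H t ht)[Q1 P1 E]; split=> //.
have f0 : f t != 0 by apply: contraNneq P1 => f0; rewrite -E f0 mul0r.
by rewrite -E mulKr ?hdiv.
Qed.

Definition conj_stable g := [/\ g != 0, forall i x, V i x -> V i (cj g x)
  & forall t, T t -> g * t = t * g].

Definition cj_poly g P := \poly_(i < size P) cj g P`_i.

Lemma coef_cj_poly g P i : (cj_poly g P)`_i = cj g P`_i.
Proof.
rewrite coef_poly; case: ltnP => // le.
by rewrite nth_default // cj0.
Qed.

Lemma cj_poly_horner g P t : g != 0 -> g * t = t * g -> (cj_poly g P).[t] = cj g P.[t].
Proof.
move=> g0 gt; rewrite horner_poly horner_coef.
rewrite (big_morph (cj g) (cjD g) (cj0 g)); apply: eq_bigr => i _.
by rewrite cjM // cjX // (cj_fix hdiv g0 gt).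
Qed.

Lemma fraction_cj g f k : conj_stable g -> fraction f k ->
  fraction (fun t => cj g (f t)) (cj g k).
Proof.
move=> [g0 gV gT] [P [Q [W [[hP hQ hW] [P0 Q0] -> W0 H]]]].
exists (cj_poly g P), (cj_poly g Q), W; split=> //.
- by split=> // i; rewrite coef_cj_poly; apply: gV.
- by rewrite !coef_cj_poly P0 Q0 cj1.
- by rewrite !coef_cj_poly cjB.
move=> t ht /(H t ht)[Q1 P1 E].
by rewrite !cj_poly_horner ?gT // -cjM // E; split=> //; apply: cj_neq0.
Qed.

Lemma fraction_gcomms x gs : V 1%N x -> (forall g, g \in gs -> conj_stable g) ->
  fraction (fun t => gcomms (1 + x * t) gs) (deltas x gs).
Proof.
move=> hx; elim/last_ind: gs => [|gs g IH] H.
  have h1 : (1 + x%:P * 'X : {poly D}) != 0.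
    apply/eqP => /(congr1 (fun p : {poly D} => p`_0)) /eqP.
    by rewrite coefD coef1 coefMX addr0 coef0 oner_eq0.
  have hh : homog (1 + x%:P * 'X).
    by apply: homogD; [apply: homog1 | rewrite -['X]expr1; apply: homogCXn].
  exists (1 + x%:P * 'X), 1, (1 + x%:P * 'X); split=> //.
  - by split=> //; apply: homog1.
  - by rewrite coefD coef1 coefMX addr0.
  - by rewrite coefD coefMX coefC !coef1 add0r subr0.
  move=> t ht nz; rewrite hornerC oner_neq0; split=> //.
  by rewrite mulr1 /= hornerD hornerC hornerMX hornerC.
have hgs g' : g' \in gs -> conj_stable g'.
  by move=> h; apply: H; rewrite mem_rcons in_cons h orbT.
have {hgs}IH := IH hgs.
have hg : conj_stable g by apply: H; rewrite mem_rcons mem_head.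
have := fractionM IH (fractionV (fraction_cj hg IH)).
rewrite /gcomms /deltas !foldl_rcons.
rewrite [X in fraction _ X -> _](_ : _ = delta g (deltas x gs)) //.
rewrite [X in _ -> fraction X _](_ : _ = fun t => gcomm g (gcomms (1 + x * t) gs)) //.
by apply/funext => t; rewrite foldl_rcons.
Qed.

(** A group word in [1 + x t] that is constant in [t] has derivative [0] at
[t = 0], even though only its values on [T] are known: the word is a fraction
[P / Q] with [P = c Q] on [T], hence [P = c Q] as polynomials, and comparing
coefficients of degree [0] and [1] gives [c = 1] and the claim. *)
Lemma linear_principle x gs c : V 1%N x -> V 0%N c ->
  (forall g, g \in gs -> conj_stable g) ->
  (forall t, T t -> 1 + x * t != 0 -> gcomms (1 + x * t) gs = c) ->
  deltas x gs = 0.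
Proof.
move=> hx hc hgs H.
have [P [Q [W [[hP hQ hW] [P0 Q0] -> W0 Ht]]]] := fraction_gcomms hx hgs.
pose L : {poly D} := 1 + x%:P * 'X.
have hL : homog L by apply: homogD; [apply: homog1 | rewrite -['X]expr1; apply: homogCXn].
have L0 : L != 0.
  apply/eqP => /(congr1 (fun p : {poly D} => p`_0)) /eqP.
  by rewrite coefD coef1 coefMX addr0 coef0 oner_eq0.
have hd : homog (P - c%:P * Q) by apply: homogB => //; apply: homogM => //; apply: homogC.
have [E|nz] := eqVneq (P - c%:P * Q) 0.
  move/eqP: E; rewrite subr_eq0 => /eqP E.
  have c1 : c = 1.
    by have /(congr1 (fun p : {poly D} => p`_0)) := E; rewrite coefCM P0 Q0 mulr1.
  by rewrite E c1 mul1r subrr.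
have [t ht] := T_sep (homogM (homogM hd hW) hL) (polyD_mul_neq0 (polyD_mul_neq0 nz W0) L0).
rewrite !homog_hornerM // => nzt.
have Wt : W.[t] != 0 by apply: contraNneq nzt => ->; rewrite mulr0 mul0r.
have Lt : 1 + x * t != 0.
  apply: contraNneq nzt => Z.
  suff -> : L.[t] = 0 by rewrite mulr0.
  by rewrite /L hornerD hornerC hornerMX hornerC Z.
have [_ _] := Ht t ht Wt; rewrite H // => E.
move: nzt; rewrite hornerD hornerN homog_hornerM // hornerC E subrr.
by rewrite !mul0r eqxx.
Qed.

End Graded.

(** * Unipotent conjugations *)

Section Unipotent.
Variable D : unitRingType.
Hypothesis hdiv : forall x : D, x != 0 -> x \is a GRing.unit.
Implicit Types (x y z g h : D).

Lemma natr0_prime n : (0 < n)%N -> n%:R = 0 :> D -> exists2 p, prime p & p%:R = 0 :> D.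
Proof.
have [m] := ubnP n; elim: m n => // m IH n lt n0 E.
have n1 : (1 < n)%N.
  by case: n n0 E {lt} => [|[|n]] // _ /eqP; rewrite oner_eq0.
have pp := pdiv_prime n1.
have En : n = (pdiv n * (n %/ pdiv n))%N by rewrite mulnC divnK ?pdiv_dvd.
move: E; rewrite {1}En natrM => /(div_mulf_eq0 hdiv)[E|E]; first by exists (pdiv n).
apply: (IH (n %/ pdiv n)%N) => //.
  by apply: leq_trans (ltn_Pdiv (prime_gt1 pp) n0) _; rewrite -ltnS.
by rewrite divn_gt0 ?pdiv_gt0 // pdiv_leq.
Qed.

Lemma prime_pow_eq1 p x : prime p -> p%:R = 0 :> D -> x ^+ p = 1 -> x = 1.
Proof.
move=> pp p0 E; have pch : p \in [pchar D] by rewrite inE /= pp p0 eqxx.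
have /= := pFrobenius_autB_comm pch (commr1 x).
rewrite !pFrobenius_autE E expr1n subrr => Z.
apply: contrapT => /eqP; rewrite -subr_eq0 => nz.
by have := div_expf_neq0 hdiv p nz; rewrite Z eqxx.
Qed.

Lemma deltas_nseq g x n gs : deltas x (nseq n g ++ gs) = deltas (iter n (delta g) x) gs.
Proof. by elim: n x => //= n IH x; rewrite IH -iterSr. Qed.

Lemma gcomms_nseq g x n gs : gcomms x (nseq n g ++ gs) = gcomms (iter n (gcomm g) x) gs.
Proof. by elim: n x => //= n IH x; rewrite IH -iterSr. Qed.

Lemma iter_delta0 g n : iter n (delta g) 0 = 0.
Proof. by elim: n => //= n ->; rewrite delta0. Qed.

Lemma deltaB g x y : delta g (x - y) = delta g x - delta g y.
Proof. by rewrite /delta cjB !opprB [cj g y - cj g x]addrC addrACA [- y + _]addrC. Qed.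

Lemma cj_nat g n : g != 0 -> cj g n%:R = n%:R.
Proof. by move=> g0; apply: cj_fix => //; rewrite mulr_natl mulr_natr. Qed.

Lemma delta_nat g n z : g != 0 -> delta g (n%:R * z) = n%:R * delta g z.
Proof. by move=> g0; rewrite /delta cjM // cj_nat // mulrBr. Qed.

(** This is the Leibniz rule for the twisted derivation [1 - Ad g], iterated:
multiplying by [y] shifts because [Ad g] sends [y + k] to [y + k + 1]. *)
Lemma iter_delta_mul g x y k : g != 0 -> cj g y = y + 1 ->
  iter k.+1 (delta g) (x * y) =
    iter k.+1 (delta g) x * (y + k.+1%:R) - k.+1%:R * iter k (delta g) x.
Proof.
move=> g0 hy.
have step u (c : nat) : delta g (u * (y + c%:R)) = delta g u * (y + c.+1%:R) - u.
  rewrite {1}/delta cjM // cjD hy cj_nat // -addrA [1 + _]addrC natr1 /delta mulrBl.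
  rewrite addrAC; congr (_ - _).
  by rewrite -natr1 addrA [in RHS]mulrDr mulr1 addrK.
elim: k => [|k IH]; first by have := step x 0%N; rewrite addr0 mul1r.
rewrite iterS IH deltaB step -addrA -opprD; congr (_ - _).
by rewrite delta_nat // -[k.+2%:R]natr1 mulrDl mul1r addrC.
Qed.

Variable K : set D.
Hypothesis hK : divsubring K.

(** On a Jordan chain of length two ending in a fixed vector [e], with preimage
[z], the element [- z e^-1] is shifted by [1].  If [n] is the exact order of
nilpotency, the Leibniz rule applied to [x y] then gives
[n * delta^(n-1) x = 0], so the characteristic is not [0]. *)
Lemma unipotent_shift g r : g != 0 -> (forall x, K x -> K (cj g x)) ->
  (forall x, K x -> iter r (delta g) x = 0) ->
  (exists2 x, K x & delta g x != 0) ->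
  (exists2 y, K y & cj g y = y + 1) /\ (exists2 p, prime p & p%:R = 0 :> D).
Proof.
move=> g0 gK nilp [x Kx dx].
have Kit n z : K z -> K (iter n (delta g) z).
  by move=> Kz; elim: n => //= n IH; apply: ds_delta => //; apply: gK.
have [y Ky hy] : exists2 y, K y & cj g y = y + 1.
  have ex : exists n, iter n (delta g) x == 0 by exists r; rewrite nilp.
  case: (ex_minnP ex) => n /eqP n0 nmin.
  case: n => [|[|n]] in n0 nmin *.
  - by move: dx; rewrite (n0 : x = 0) delta0 eqxx.
  - by move: dx; rewrite (n0 : delta g x = 0) eqxx.
  have e0 : iter n.+1 (delta g) x != 0.
    by apply/negP => /nmin; rewrite ltnn.
  set z := iter n (delta g) x; set e := iter n.+1 (delta g) x.
  have ce : cj g e = e by apply: cj_fix => //; apply: delta_eq0.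
  have cz : cj g z = z - e by rewrite /e /= -/z /delta opprB addrC subrK.
  exists (- (z * e^-1)).
    by apply: dsN => //; apply: dsM => //; [apply: Kit|apply: dsV; [|apply: Kit]].
  rewrite cjN cjM // cjV // ce cz mulrBl divrr ?hdiv //.
  by rewrite opprB addrC.
split; first by exists y.
have exN : exists n, `[< forall x, K x -> iter n (delta g) x = 0 >].
  by exists r; apply/asboolP.
case: (ex_minnP exN) => -[|N] /asboolP hN Nmin.
  by move: dx; rewrite (hN _ Kx : x = 0) delta0 eqxx.
have [x0 Kx0 hx0] : exists2 x0, K x0 & iter N (delta g) x0 != 0.
  apply: contrapT => H; suff /Nmin : `[< forall x, K x -> iter N (delta g) x = 0 >].
    by rewrite ltnn.
  apply/asboolP => z Kz; apply/eqP/contraT => nz.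
  by case: H; exists z.
have := iter_delta_mul x0 N g0 hy.
rewrite (hN _ (dsM hK Kx0 Ky)) (hN _ Kx0) mul0r sub0r => /eqP.
rewrite eq_sym oppr_eq0 => /eqP /(div_mulf_eq0 hdiv)[E|E].
  exact: (@natr0_prime N.+1).
by rewrite E eqxx in hx0.
Qed.

(** Let [u] be the last iterated commutator different from [1]; it commutes with
[g] and is [v * (g v g^-1)^-1] for some [v], so [v = u^p * (g^p v g^-p)].  But
[g^p] commutes with [y], which it shifts by [p], hence with [v]; thus [u^p = 1],
and [u = 1] in characteristic [p]. *)
Lemma gcomm_shift_neq1 g y p n : g != 0 -> cj g y = y + 1 -> prime p ->
  p%:R = 0 :> D -> y != 0 /\ iter n (gcomm g) y != 1.
Proof.
move=> g0 hy pp p0.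
have y0 : y != 0.
  by apply/eqP => y0; move: hy; rewrite y0 cj0 add0r => /eqP; rewrite eq_sym oner_eq0.
have c0 k : iter k (gcomm g) y != 0 by elim: k => //= k IH; apply: gcomm_neq0.
have cjXg k z : cj (g ^+ k) z = iter k (cj g) z.
  elim: k z => [|k IH] z; first by rewrite expr0 cj1l.
  by rewrite exprS -cj_cj ?div_expf_neq0 //= IH.
have gpy : cj (g ^+ p) y = y.
  have -> : cj (g ^+ p) y = y + p%:R.
    rewrite cjXg; elim: (p) => [|k IH]; first by rewrite addr0.
    rewrite iterS IH cjD hy cj_nat //.
    by rewrite -addrA -natr1 [1 + _]addrC.
  by rewrite p0 addr0.
have gp0 : g ^+ p != 0 by apply: div_expf_neq0.
have gpc k : cj (g ^+ p) (iter k (gcomm g) y) = iter k (gcomm g) y.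
  elim: k => //= k IH; rewrite /gcomm cjM // cjV // IH; congr (_ * _^-1).
  by rewrite cj_cj // -exprSr exprS -cj_cj // IH.
split=> //; elim: n => [|n IH].
  apply/eqP => /= E; move: hy; rewrite E cj1 // => /eqP.
  by rewrite -subr_eq0 opprD addrA subrr sub0r oppr_eq0 oner_eq0.
apply/eqP => E; case: n => [|n] in IH E.
  move: hy; rewrite /= in E; rewrite cj_fix //; last exact: gcomm_eq1.
  move=> /eqP; by rewrite -subr_eq0 opprD addrA subrr sub0r oppr_eq0 oner_eq0.
case/negP: IH; apply/eqP.
set v := iter n (gcomm g) y; set u := iter n.+1 (gcomm g) y.
have v0 : v != 0 by apply: c0.
have gu : cj g u = u by apply: cj_fix => //; apply: gcomm_eq1 => //; apply: c0.
have vE : v = u * cj g v by rewrite /u /= -/v /gcomm mulrVK ?hdiv ?cj_neq0.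
have vk k : v = u ^+ k * iter k (cj g) v.
  elim: k => [|k IH]; first by rewrite mul1r.
  have /(congr1 (cj g)) := IH; rewrite cjM // cjX // gu => E1.
  by rewrite {1}vE E1 mulrA -exprS.
have := vk p; rewrite -cjXg gpc => E1.
apply: (prime_pow_eq1 pp p0); apply: (div_mulIf hdiv v0).
by rewrite mul1r -E1.
Qed.

End Unipotent.

(** * Finite subrings of a division ring *)

Section FiniteSubring.
Variable D : unitRingType.
Hypothesis hdiv : forall x : D, x != 0 -> x \is a GRing.unit.
Variable s : seq D.

Definition in_seq : {pred D} := fun x => x \in s.
Hypothesis s_ring : subring_closed in_seq.

(** Multiplication by a nonzero element permutes a finite subring, so the
inverse belongs to it. *)
Lemma finite_subring_divring : divring_closed in_seq.
Proof.
have [s1 sB sM] := s_ring.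
have s0 : 0 \in s by rewrite -(subrr 1); apply: sB.
split=> // x y xs ys; apply: (sM _ _ xs).
have [->|y0] := eqVneq y 0; first by rewrite invr0.
have inj : injective ( *%R y) by move=> a b; apply: div_mulfI.
have sub : {subset map ( *%R y) (undup s) <= undup s}.
  by move=> _ /mapP[a + ->]; rewrite !mem_undup => ?; apply: sM.
have u : uniq (map ( *%R y) (undup s)) by rewrite map_inj_uniq ?undup_uniq.
have [|_ E] := uniq_min_size u sub _; first by rewrite size_map.
have : 1 \in undup s by rewrite mem_undup.
rewrite -E => /mapP[a]; rewrite mem_undup => ha E1.
rewrite [_ \in _](_ : _ = (y^-1 \in s)) //.
by have -> : y^-1 = a by apply: (div_mulfI hdiv y0); rewrite -E1 divrr ?hdiv.
Qed.

(** The finite subring becomes a finite type, to which Wedderburn's little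
theorem and the identity [x^#|S| = x] of finite fields apply. *)
HB.instance Definition _ := GRing.isDivringClosed.Build D in_seq finite_subring_divring.
Definition subring_type := {x : D | in_seq x}.
HB.instance Definition _ := [isSub of subring_type for sval].
Let f (x : subring_type) : seq_sub s := SeqSub (svalP x : sval x \in s).
Let g (x : seq_sub s) : subring_type := exist _ (ssval x) (ssvalP x).
Let fK : cancel f g. Proof. by case=> x hx; apply/val_inj. Qed.
HB.instance Definition _ := Finite.copy subring_type (can_type fK).
HB.instance Definition _ := [SubChoice_isSubUnitRing of subring_type by <:].

Lemma subring_type_domain : GRing.integral_domain_axiom subring_type.
Proof.
move=> x y /(congr1 val); rewrite rmorphM rmorph0 => /(div_mulf_eq0 hdiv).
by case=> E; apply/orP; [left|right]; apply/eqP/val_inj; rewrite E rmorph0.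
Qed.

Lemma finite_subring_comm x y : x \in s -> y \in s -> x * y = y * x.
Proof.
move=> xs ys; pose X : subring_type := exist _ x xs; pose Y : subring_type := exist _ y ys.
exact: (congr1 val (finDomain_mulrC subring_type_domain X Y)).
Qed.

Lemma finite_subring_card x : x \in s -> x ^+ size (undup s) = x.
Proof.
move=> xs; pose X : subring_type := exist _ x xs.
have E : X ^+ #|{: subring_type}| = X.
  exact: (expf_card (X : FinDomainFieldType subring_type_domain)).
have /(congr1 val) := E; rewrite rmorphXn /=.
have -> // : #|{: subring_type}| = size (undup s).
rewrite -(card_seq_sub (undup_uniq s)).
have h (z : seq_sub (undup s)) : ssval z \in s by rewrite -mem_undup; apply: ssvalP.
have h' (z : subring_type) : sval z \in undup s by rewrite mem_undup; apply: (svalP z).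
apply/esym/(@bij_eq_card _ _ (fun z => exist _ (ssval z) (h z) : subring_type)).
exists (fun z => SeqSub (h' z)) => z; apply/val_inj => //.
Qed.
End FiniteSubring.

(** * Separating points, graded division rings, spans of powers *)

Section Instances.
Variable D : unitRingType.
Hypothesis hdiv : forall x : D, x != 0 -> x \is a GRing.unit.
Implicit Types (x y z g h t : D) (K L X T : set D) (P Q R : {poly D}).

Definition subring X := [/\ X 1, forall x y, X x -> X y -> X (x - y)
  & forall x y, X x -> X y -> X (x * y)].

Lemma finite_set_subring X : finite_set X -> subring X ->
  exists2 s : seq D, uniq s & X = [set` s] /\ subring_closed (in_seq s).
Proof.
move=> /finite_seqP[s ->] [h1 hB hM]; exists (undup s); first exact: undup_uniq.
have E : [set` undup s] = [set` s] by apply/seteqP; split=> x /=; rewrite mem_undup.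
by rewrite E; split=> //; split=> [|x y|x y]; rewrite /in_seq ![_ \in (fun _ => _)]/in_mem /= !mem_undup //;
  [apply: hB | apply: hM].
Qed.

Lemma finite_set_comm X x y : finite_set X -> subring X -> X x -> X y -> x * y = y * x.
Proof.
move=> fX rX; have [s _ [-> hs]] := finite_set_subring fX rX.
exact: finite_subring_comm.
Qed.

Lemma infinite_seq X n : ~ finite_set X -> exists s : seq D,
  [/\ uniq s, size s = n & forall x, x \in s -> X x].
Proof.
move=> iX; elim: n => [|n [s [us ss hs]]]; first by exists [::].
have [x Xx xs] : exists2 x, X x & x \notin s.
  apply: contrapT => H; apply: iX; apply: (sub_finite_set _ (finite_seq s)) => x Xx /=.
  by apply: contrapT => /negP xs; apply: H; exists x.
exists (x :: s); split=> /=; rewrite ?us ?xs ?ss // => y.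
by rewrite in_cons => /orP[/eqP->|/hs].
Qed.

Lemma comm_uniq_roots (s : seq D) : uniq s ->
  (forall x y, x \in s -> y \in s -> x * y = y * x) -> uniq_roots s.
Proof.
elim: s => //= x s IH /andP[xs us] H; apply/andP; split.
  apply/allP => y ys; rewrite /diff_roots (H x y) ?eqxx ?in_cons ?ys ?orbT //=.
    apply: hdiv; rewrite subr_eq0; apply: contraNneq xs => <- //.
  by rewrite eqxx.
by apply: IH => // a b sa sb; apply: H; rewrite in_cons ?sa ?sb orbT.
Qed.

Lemma infinite_nonroot X P : (forall x y, X x -> X y -> x * y = y * x) ->
  ~ finite_set X -> P != 0 -> exists2 t, X t & P.[t] != 0.
Proof.
move=> cX iX P0; apply: contrapT => H.
have [s [us ss hs]] := infinite_seq (size P) iX.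
have := max_ring_poly_roots P0 (rs := s); rewrite ss ltnn => K.
suff : false by []; apply: K.
  apply/allP => t /hs Xt; apply: contrapT => /negP nz.
  by apply: H; exists t.
by apply: comm_uniq_roots => // x y /hs Xx /hs Xy; apply: cX.
Qed.

Lemma finite_roots X P : (forall x y, X x -> X y -> x * y = y * x) -> P != 0 ->
  finite_set [set t | X t /\ P.[t] = 0].
Proof.
move=> cX P0; apply: contrapT => H.
have [|t [_ E]] := infinite_nonroot _ H P0; last by rewrite E eqxx.
by move=> x y [Xx _] [Xy _]; apply: cX.
Qed.

Lemma constant_graded K : divsubring K -> graded_division (fun=> K) 1.
Proof.
move=> hK; split=> //=; try by [apply: ds1|apply: oner_neq0].
- by move=> _ x y; apply: dsB.
- by move=> _ _ x y; apply: dsM.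
- by move=> _ _ x y Kx _ Ky; apply: dsM => //; apply: dsV.
- by move=> _ _ x y Kx _ Ky; apply: dsM => //; apply: dsV.
Qed.

Definition skew_component L h i : set D := [set l * h ^+ i | l in L].

Lemma cj_expr_stable L h i : h != 0 -> (forall x, L x -> L (cj h x)) ->
  forall x, L x -> L (cj (h ^+ i) x).
Proof.
move=> h0 Lh; elim: i => [|i IH] x Lx; first by rewrite expr0 cj1l.
by rewrite exprS -cj_cj ?div_expf_neq0 //; apply: Lh; apply: IH.
Qed.

Lemma skew_graded L h : divsubring L -> h != 0 -> (forall x, L x -> L (cj h x)) ->
  (forall x, L x -> L (cj h^-1 x)) -> graded_division (skew_component L h) h.
Proof.
move=> hL h0 Lh Lh'.
have Lc i := cj_expr_stable i h0 Lh.
have Lc' i x : L x -> L (cj (h ^+ i)^-1 x).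
  by rewrite -exprVn; apply: cj_expr_stable => //; apply: div_invr_neq0.
have hn i : h ^+ i != 0 by apply: div_expf_neq0.
split=> //.
- move=> i _ _ [l Ll <-] [m Lm <-]; exists (l - m); first exact: dsB.
  by rewrite mulrBl.
- move=> i j _ _ [l Ll <-] [m Lm <-]; exists (l * cj (h ^+ i) m).
    by apply: dsM => //; apply: Lc.
  by rewrite exprD -!mulrA; congr (_ * _); rewrite !mulrA cj_mulr.
- move=> i j _ _ [l Ll <-] + [m Lm <-].
  have [->|l0] := eqVneq l 0; first by rewrite mul0r eqxx.
  move=> _; exists (cj (h ^+ i)^-1 (l^-1 * m)).
    by apply: Lc'; apply: dsM => //; apply: dsV.
  by rewrite invrM ?hdiv // /cj invrK exprD !mulrA.
- move=> i j _ _ [l Ll <-] + [m Lm <-].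
  have [->|l0] := eqVneq l 0; first by rewrite mul0r eqxx.
  move=> _; exists (m * cj (h ^+ j) l^-1).
    by apply: dsM => //; apply: Lc; apply: dsV.
  rewrite invrM ?hdiv // exprD -!mulrA; congr (_ * _); rewrite !mulrA cj_mulr //.
  by rewrite mulrK ?hdiv.
- by exists 1; [apply: ds1|rewrite mulr1].
- by exists 1; [apply: ds1|rewrite mul1r expr1].
Qed.

(** These are the left [L]-combinations of [1, h, .., h^(N-1)]; when [h] is a
root of a monic polynomial of degree [N], they form the ring [L[h]]. *)
Definition power_span L h N : set D := [set y | exists2 c : 'I_N -> D,
  (forall i, L (c i)) & y = \sum_(i < N) c i * h ^+ i].

Lemma finite_power_span L h N : finite_set L -> finite_set (power_span L h N).
Proof.
move=> /finite_seqP[s Ls].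
apply: (@sub_finite_set _ _ [set (\sum_(i < N) ssval (c i) * h ^+ i) | c in [set: {ffun 'I_N -> seq_sub s}]]).
  move=> _ [c hc ->]; have hc' i : c i \in s by have := hc i; rewrite Ls.
  exists [ffun i => SeqSub (hc' i)] => //.
  by apply: eq_bigr => i _; rewrite ffunE.
by apply: finite_image; apply: finite_finset.
Qed.

Lemma power_span_subring L h N : divsubring L -> h != 0 -> (forall x, L x -> L (cj h x)) ->
  power_span L h N (h ^+ N) -> [/\ subring (power_span L h N), power_span L h N h & L `<=` power_span L h N].
Proof.
move=> hL h0 Lh [d hd hN].
have Lc i := cj_expr_stable i h0 Lh.
have SB x y : power_span L h N x -> power_span L h N y -> power_span L h N (x - y).
  move=> [a ha ->] [b hb ->]; exists (fun i => a i - b i).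
    by move=> i; apply: dsB.
  by rewrite -sumrB; apply: eq_bigr => i _; rewrite mulrBl.
have SL l x : L l -> power_span L h N x -> power_span L h N (l * x).
  move=> Ll [a ha ->]; exists (fun i => l * a i); first by move=> i; apply: dsM.
  by rewrite mulr_sumr; apply: eq_bigr => i _; rewrite mulrA.
have SR l x : L l -> power_span L h N x -> power_span L h N (x * l).
  move=> Ll [a ha ->]; exists (fun i => a i * cj (h ^+ i) l).
    by move=> i; apply: dsM => //; apply: Lc.
  rewrite mulr_suml; apply: eq_bigr => i _.
  by rewrite /cj -!mulrA mulVr ?mulr1 // hdiv // div_expf_neq0.
have S0 : power_span L h N 0 by rewrite -(subrr (h ^+ N)); apply: SB; exists d.
have SD x y : power_span L h N x -> power_span L h N y -> power_span L h N (x + y).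
  move=> hx hy; rewrite -[y]opprK; apply: (SB _ _ hx).
  by rewrite -sub0r; apply: SB.
have Sm i : (i <= N)%N -> power_span L h N (h ^+ i).
  rewrite leq_eqVlt => /orP[/eqP->|lt]; first by exists d.
  exists (fun j => if j == Ordinal lt then 1 else 0).
    by move=> j; case: eqP => _; [apply: ds1|apply: ds0].
  rewrite (bigD1 (Ordinal lt)) //= eqxx mul1r big1 ?addr0 // => j /negPf ->.
  by rewrite mul0r.
have SH x : power_span L h N x -> power_span L h N (x * h).
  move=> [a ha ->]; rewrite mulr_suml; apply: (big_ind (power_span L h N)) => // i _.
  by rewrite -mulrA -exprSr; apply: SL => //; apply: Sm.
have SHn n x : power_span L h N x -> power_span L h N (x * h ^+ n).
  elim: n x => [|n IH] x hx; first by rewrite mulr1.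
  by rewrite exprS mulrA; apply: IH; apply: SH.
have S1 : power_span L h N 1 by apply: (Sm 0%N).
split; last by move=> l Ll; rewrite -[l]mulr1; apply: SL.
  split=> // x y hx [b hb ->]; rewrite mulr_sumr.
  apply: (big_ind (power_span L h N)) => // i _.
  by rewrite mulrA; apply: SHn; apply: SR.
by have := SH _ S1; rewrite mul1r.
Qed.

(** The ring [L[h]] is finite, so it is commutative by Wedderburn's theorem. *)
Lemma finite_normalized_comm L h N l : finite_set L -> divsubring L -> h != 0 ->
  (forall x, L x -> L (cj h x)) -> power_span L h N (h ^+ N) -> L l -> h * l = l * h.
Proof.
move=> fL hL h0 Lh hN Ll; have [rS Sh LS] := power_span_subring hL h0 Lh hN.
exact: (finite_set_comm (finite_power_span h N fL) rS Sh (LS _ Ll)).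
Qed.

End Instances.

(** * Elements algebraic over a division subring *)

Section Algebraic.
Variable D : unitRingType.
Hypothesis hdiv : forall x : D, x != 0 -> x \is a GRing.unit.
Implicit Types (x y z g h t : D) (K L X T : set D) (P Q R : {poly D}).

Definition coefs_in X P := forall i, X P`_i.

Lemma minimal_root L t P : coefs_in L P -> P != 0 -> P.[t] = 0 ->
  exists R, [/\ coefs_in L R, R != 0, R.[t] = 0 &
    forall S, coefs_in L S -> S.[t] = 0 -> (size S < size R)%N -> S = 0].
Proof.
have [n] := ubnP (size P); elim: n P => // n IH P lt hP P0 Pt.
have [H|H] := pselect (forall S, coefs_in L S -> S.[t] = 0 -> (size S < size P)%N -> S = 0).
  by exists P.
have [S [hS St lS S0]] : exists S, [/\ coefs_in L S, S.[t] = 0, (size S < size P)%N & S != 0].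
  apply: contrapT => K; apply: H => S hS St lS; apply/eqP/contraT => S0.
  by case: K; exists S.
by apply: (IH S) => //; apply: leq_trans lS _.
Qed.

(** The minimal polynomial of [t] over [K] has central coefficients: its
commutator with a constant of [K] vanishes at [t] and has smaller degree. *)
Lemma central_root K t R : divsubring K -> (forall x, K x -> t * x = x * t) ->
  (forall c, K c -> (forall y, K y -> c * y = y * c) -> center D c) ->
  coefs_in K R -> R != 0 -> R.[t] = 0 ->
  exists P, [/\ coefs_in (center D) P, P != 0 & P.[t] = 0].
Proof.
move=> hK tK hZ hR0 R00 Rt0.
have [{R00 Rt0 hR0}R [hR R0 Rt Rmin]] := minimal_root hR0 R00 Rt0.
pose l := lead_coef R; have l0 : l != 0 by rewrite lead_coef_eq0.
have Kl : K l by apply: hR.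
pose P := l^-1%:P * R.
have hP : coefs_in K P by move=> i; rewrite coefCM; apply: dsM => //; apply: dsV.
have P0 : P != 0 by apply: polyD_mul_neq0 => //; rewrite polyC_eq0 div_invr_neq0.
have Pt : P.[t] = 0 by rewrite hornerCM Rt mulr0.
have sP : size P = size R.
  rewrite size_proper_mul ?lead_coefC; last by rewrite div_mulf_neq0 ?div_invr_neq0.
  by rewrite size_polyC div_invr_neq0.
have Pm : P`_(size P).-1 = 1.
  rewrite -lead_coefE /P lead_coef_proper_mul lead_coefC; first by rewrite mulVr ?hdiv.
  by rewrite div_mulf_neq0 ?div_invr_neq0.
clearbody P; exists P; split=> // i; apply: hZ => // c Kc.
have hS : coefs_in K (c%:P * P - P * c%:P).
  move=> j; rewrite coefB coefCM coefMC.
  by apply: dsB => //; apply: dsM.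
have tc : comm_poly c%:P t by rewrite /comm_poly hornerC tK.
have St : (c%:P * P - P * c%:P).[t] = 0.
  by rewrite hornerD hornerN hornerCM hornerM_comm // Pt mulr0 mul0r subrr.
have S0 : c%:P * P - P * c%:P = 0.
  apply: Rmin => //; rewrite -sP -[X in (_ < X)%N]prednK ?size_poly_gt0 // ltnS.
  apply/leq_sizeP => j; rewrite leq_eqVlt coefB coefCM coefMC => /orP[/eqP <-|lt].
    by rewrite Pm mul1r mulr1 subrr.
  by rewrite nth_default ?mulr0 ?mul0r ?subrr // -(prednK (n := size P)) ?size_poly_gt0.
have /(congr1 (fun p : {poly D} => p`_i)) := S0.
by rewrite coefB coefCM coefMC coef0 => /eqP; rewrite subr_eq0 => /eqP.
Qed.

Lemma span_root L t P : divsubring L -> coefs_in L P -> P != 0 -> P.[t] = 0 ->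
  power_span L t (size P).-1 (t ^+ (size P).-1).
Proof.
move=> hL hP P0; rewrite horner_coef -(prednK (n := size P)) ?size_poly_gt0 //=.
set N := (size P).-1; rewrite big_ord_recr /= => E.
have l0 : P`_N != 0 by rewrite -lead_coefE lead_coef_eq0.
exists (fun i => - (P`_N)^-1 * P`_i).
  by move=> i; rewrite mulNr; apply: dsN => //; apply: dsM => //; apply: dsV.
apply: (div_mulfI hdiv l0); move/eqP: E; rewrite addrC addr_eq0 => /eqP ->.
rewrite mulr_sumr -sumrN; apply: eq_bigr => i _.
by rewrite !mulNr mulrN -mulrA mulVKr ?hdiv.
Qed.

(** As in Dedekind's lemma on characters, conjugation by [h^i] acts on [L] in
the same way for all monomials [r_i h^i] of a relation of minimal degree; two of
these monomials give a power of [h] that commutes with [L]. *)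
Lemma finite_order L h P : divsubring L -> (forall x y, L x -> L y -> x * y = y * x) ->
  h != 0 -> (forall x, L x -> L (cj h x)) ->
  coefs_in L P -> P != 0 -> P.[h] = 0 ->
  exists2 n, (0 < n)%N & forall l, L l -> cj (h ^+ n) l = l.
Proof.
move=> hL cL h0 Lh hP P0 Ph.
have [{P hP P0 Ph}R [hR R0 Rh Rmin]] := minimal_root hP P0 Ph.
have Lc i := cj_expr_stable hdiv i h0 Lh.
have hn i : h ^+ i != 0 by apply: div_expf_neq0.
pose N := (size R).-1.
have SR : size R = N.+1 by rewrite prednK ?size_poly_gt0.
have l0 : R`_N != 0 by rewrite -lead_coefE lead_coef_eq0.
have key b i : L b -> R`_i != 0 -> cj (h ^+ i) b = cj (h ^+ N) b.
  move=> Lb Ri; pose S := \poly_(j < size R) (R`_j * cj (h ^+ j) b - cj (h ^+ N) b * R`_j).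
  have cS j : S`_j = R`_j * cj (h ^+ j) b - cj (h ^+ N) b * R`_j.
    rewrite coef_poly; case: ltnP => // le.
    by rewrite nth_default // mul0r mulr0 subrr.
  have S0 : S = 0.
    apply: Rmin.
    - by move=> j; rewrite cS; apply: dsB => //; apply: dsM => //; apply: Lc.
    - rewrite horner_poly; transitivity (R.[h] * b - cj (h ^+ N) b * R.[h]); last first.
        by rewrite Rh mulr0 mul0r subrr.
      rewrite horner_coef mulr_suml mulr_sumr -sumrB; apply: eq_bigr => j _.
      rewrite mulrBl; congr (_ - _); last by rewrite mulrA.
      by rewrite -[LHS]mulrA cj_mulr // mulrA.
    - rewrite SR ltnS; apply/leq_sizeP => j; rewrite leq_eqVlt cS => /orP[/eqP <-|lt].
        by rewrite cL ?subrr //; apply: Lc.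
      by rewrite nth_default ?mul0r ?mulr0 ?subrr // SR.
  apply: (div_mulfI hdiv Ri); apply/eqP; rewrite -subr_eq0.
  have := cS i; rewrite S0 coef0 => E.
  by rewrite [X in _ - X]cL; [rewrite -E | apply: hR | apply: Lc].
have [i lt Ri] : exists2 i, (i < N)%N & R`_i != 0.
  apply: contrapT => H; have := Rh; rewrite horner_coef SR big_ord_recr /= big1 => [|i _].
    by rewrite add0r => /(div_mulf_eq0 hdiv)[/eqP|/eqP]; apply/negP.
  have [->|nz] := eqVneq R`_i 0; first by rewrite mul0r.
  by case: H; exists i.
exists (N - i)%N; first by rewrite subn_gt0.
move=> l Ll; have := key l i Ll Ri; rewrite -{1}(subnKC (ltnW lt)) exprD -cj_cj // => E.
by rewrite -[LHS](cjK hdiv _ (hn i)) -E cjK.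
Qed.

Lemma cj_polyM g P Q : g != 0 -> cj_poly g (P * Q) = cj_poly g P * cj_poly g Q.
Proof.
move=> g0; apply/polyP => i; rewrite coef_cj_poly !coefM.
rewrite (big_morph (cj g) (cjD g) (cj0 g)); apply: eq_bigr => j _.
by rewrite cjM // !coef_cj_poly.
Qed.

(** Each [l] in [L] is a root of the product of the [X - h^i l h^-i], a
polynomial of degree [n] whose coefficients are fixed by [h].  If there are
finitely many fixed elements, there are finitely many such polynomials, each
with finitely many roots in [L]. *)
Lemma infinite_fixed L h n : divsubring L -> (forall x y, L x -> L y -> x * y = y * x) ->
  h != 0 -> (forall x, L x -> L (cj h x)) -> (0 < n)%N ->
  (forall l, L l -> cj (h ^+ n) l = l) -> ~ finite_set L ->
  ~ finite_set [set l | L l /\ h * l = l * h].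
Proof.
move=> hL cL h0 Lh n0 hn iL fC; apply: iL; set C := [set l | _] in fC.
have Lc i := cj_expr_stable hdiv i h0 Lh.
pose pol l : {poly D} := \prod_(i < n) ('X - (cj (h ^+ i) l)%:P).
have prodL m (F : 'I_m -> D) : (forall i, L (F i)) ->
    coefs_in L (\prod_(i < m) ('X - (F i)%:P)).
  move=> LF; apply: (big_ind (coefs_in L)).
  - by move=> i; rewrite coef1; case: eqP => _; [apply: ds1|apply: ds0].
  - move=> P Q hP hQ i; rewrite coefM; apply: (big_ind L).
    + exact: ds0.
    + by move=> ? ?; apply: dsD.
    + by move=> j _; apply: dsM.
  - move=> j _ i; rewrite coefB coefX coefC.
    apply: dsB => //; first by case: eqP => _; [apply: ds1|apply: ds0].
    by case: eqP => _; [apply: LF|apply: ds0].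
have polL l : L l -> coefs_in L (pol l) by move=> Ll; apply: prodL => i; apply: Lc.
have polC l : L l -> coefs_in C (pol l).
  move=> Ll i; split; first exact: polL.
  apply: cj_fixE => //; rewrite -coef_cj_poly; suff -> : cj_poly h (pol l) = pol l by [].
  have cX z : cj_poly h ('X - z%:P) = 'X - (cj h z)%:P.
    apply/polyP => j; rewrite coef_cj_poly !coefB !coefX !coefC cjB.
    by case: eqP => _; case: eqP => _; rewrite ?cj1 ?cj0.
  have -> : cj_poly h (pol l) = \prod_(i < n) ('X - (cj (h ^+ i.+1) l)%:P).
    have c1 : cj_poly h 1 = 1.
      apply/polyP => j; rewrite coef_cj_poly !coef1.
      by case: eqP => _; rewrite ?cj1 ?cj0.
    rewrite /pol (big_morph (cj_poly h) (fun P Q => cj_polyM P Q h0) c1).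
    by apply: eq_bigr => j _; rewrite cX cj_cj ?div_expf_neq0 // -exprS.
  rewrite /pol; case: n n0 hn {polL pol} => // m _ hm.
  rewrite big_ord_recr [in RHS]big_ord_recl /= expr0 cj1l hm //.
  apply: commr_sym; apply: commr_prod => j _.
  apply: commrB; first by apply: commr_polyX.
  apply: commr_sym; apply: commrB; first by apply: commr_polyX.
  by rewrite /GRing.comm -!polyCM cL //; apply: Lc.
have roots l : L l -> (pol l).[l] = 0.
  move=> Ll; rewrite /pol; case: n n0 {hn polL polC pol} => // m _.
  rewrite big_ord_recl expr0 cj1l hornerM_comm; first by rewrite hornerXsubC subrr mul0r.
  apply: comm_coef_poly => i; rewrite /GRing.comm cL //.
  by apply: prodL => j; apply: Lc.
have sz l : (size (pol l) < n.+2)%N by rewrite /pol size_prod_XsubC /index_enum -enumT size_enum_ord.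
have nz l : pol l != 0 by rewrite monic_neq0 // monic_prod_XsubC.
have /finite_seqP[s Cs] := fC.
pose pols := [set (\poly_(i < n.+1) (if insub (i : nat) is Some j then ssval (c (j : 'I_n.+1)) else 0) : {poly D})
  | c in [set: {ffun 'I_n.+1 -> seq_sub s}]].
have fpols : finite_set pols by apply: finite_image; apply: finite_finset.
have pol_in l : L l -> pols (pol l).
  move=> Ll; have hc (i : 'I_n.+1) : (pol l)`_i \in s by have := polC l Ll i; rewrite Cs.
  exists [ffun i => SeqSub (hc i)] => //; apply/polyP => i; rewrite coef_poly.
  case: ltnP => lt; last by rewrite nth_default //; apply: leq_trans lt; rewrite -ltnS; apply: sz.
  by rewrite insubT ffunE.
have fin : finite_set (\bigcup_(P in pols) [set t | (P != 0 /\ L t) /\ P.[t] = 0]).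
  apply: bigcup_finite => // P _; have [->|P0] := eqVneq P 0.
    by apply: (sub_finite_set _ (finite_set0 D)) => x [[]].
  by apply: sub_finite_set (finite_roots hdiv cL P0) => x [[_ Lx] Px].
apply: sub_finite_set fin => l Ll; exists (pol l); first exact: pol_in.
by split; [split=> //; apply: nz|apply: roots].
Qed.

End Algebraic.

(** * Transcendental elements over a finite center *)

Section Jacobson.
Variable D : unitRingType.
Hypothesis hdiv : forall x : D, x != 0 -> x \is a GRing.unit.
Implicit Types (x y z g h t : D) (K L X T : set D) (P Q R : {poly D}).

Lemma center_cj g x : g != 0 -> center D x -> cj g x = x.
Proof. by move=> g0 hx; apply: cj_fix => //; rewrite hx. Qed.

Definition sylvester s z v : D := v * s - z * v.

(** Evaluating [P * x] at [s], that is, replacing [X^i] by [x s^i], turns the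
factor [X - z] into the operator [v -> v s - z v]. *)
Lemma sylvester_prod s x (rs : seq D) :
  ((\prod_(z <- rs) ('X - z%:P)) * x%:P).[s] = foldr (sylvester s) x rs.
Proof.
elim: rs => [|z rs IH]; first by rewrite big_nil mul1r hornerC.
rewrite big_cons -mulrA mulrBl hornerD hornerN hornerCM IH.
by rewrite -commr_polyX hornerMX IH.
Qed.

Lemma sylvester_eigen K s x (rs : seq D) :
  (forall v z, K v -> z \in rs -> K (sylvester s z v)) ->
  K x -> x != 0 -> foldr (sylvester s) x rs = 0 ->
  exists v z, [/\ K v, v != 0, z \in rs & v * s = z * v].
Proof.
elim/last_ind: rs x => [|rs z IH] x hK Kx x0 /=; first by move/eqP; rewrite (negPf x0).
rewrite foldr_rcons => E.
have [/eqP E0|nz] := eqVneq (sylvester s z x) 0.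
  exists x, z; split=> //; first by rewrite mem_rcons mem_head.
  by move: E0; rewrite subr_eq0 => /eqP.
have [||v [w [Kv v0 wrs Ev]]] := IH (sylvester s z x) _ _ nz E.
- by move=> v w Kv wrs; apply: hK => //; rewrite mem_rcons in_cons wrs orbT.
- by apply: hK => //; rewrite mem_rcons mem_head.
by exists v, w; split=> //; rewrite mem_rcons in_cons wrs orbT.
Qed.

(** Suppose that all of [K] is algebraic over the finite center.  Then [s] lies
in a finite field [L] of [Q] elements, and [X^Q - X], the product of the [X - z]
for [z] in [L], annihilates the right multiplication by [s] on [K].  So [x]
yields [v] with [v s v^-1 = z <> s] in [L]; since [v] is algebraic too, it
generates with [L] a finite noncommutative ring, against Wedderburn's theorem. *)
Lemma finite_center_transcendental K s x : finite_set (center D) ->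
  divsubring K -> center D `<=` K -> K s -> K x -> s * x <> x * s ->
  exists2 t, K t & forall P, coefs_in (center D) P -> P != 0 -> P.[t] != 0.
Proof.
move=> fF hK FK Ks Kx sx; apply: contrapT => H.
have alg t : K t -> exists P, [/\ coefs_in (center D) P, P != 0 & P.[t] = 0].
  move=> Kt; apply: contrapT => H1; apply: H; exists t => // P hP P0.
  by apply/eqP => Pt; apply: H1; exists P.
have hF := center_divsubring hdiv.
have s0 : s != 0 by apply/eqP => s0; apply: sx; rewrite s0 mul0r mulr0.
have Fs y : center D y -> center D (cj s y) by move=> hy; rewrite center_cj.
have [P [hP P0 Ps]] := alg s Ks.
have hN := span_root hdiv hF hP P0 Ps; set N := (size P).-1 in hN.
have [rL Ls FL] := power_span_subring hdiv hF s0 Fs hN.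
have fL := finite_power_span s N fF.
set L := power_span _ _ _ in rL Ls FL fL hN.
have LK : L `<=` K.
  move=> _ [c hc ->]; apply: ds_sum => // i; apply: dsM => //; last exact: dsX.
  by apply: FK.
have cL y z : L y -> L z -> y * z = z * y by apply: finite_set_comm.
have [l ul [El rl]] := finite_set_subring fL rL.
have inL z : z \in l -> L z by rewrite El.
have lQ z : z \in l -> z ^+ size l = z.
  by move=> zl; have := finite_subring_card hdiv rl zl; rewrite undup_id.
have hL : divsubring L.
  have [h1 hB hM] := rL; split=> // y Ly.
  have [_ _ hd] := finite_subring_divring hdiv rl.
  by rewrite El -[_^-1]mul1r; apply: hd; [move: h1; rewrite El|move: Ly; rewrite El].
have sl : s \in l by move: Ls; rewrite El.
have Q2 : (1 < size l)%N.
  have u : uniq [:: 0; 1 : D] by rewrite /= inE eq_sym oner_neq0.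
  apply: (uniq_leq_size u) => z; rewrite !inE => /orP[]/eqP ->.
    by have := ds0 hL; rewrite El.
  by have := ds1 hL; rewrite El.
(* [s] is the root applied first, so that [x] is replaced by [x s - s x <> 0]. *)
pose rs := rcons (rem s l) s.
have prs : perm_eq l rs by rewrite (permPl (perm_to_rem sl)) perm_sym perm_rcons.
have Xprod : 'X^(size l) - 'X = \prod_(z <- rs) ('X - z%:P) :> {poly D}.
  have sp : size ('X^(size l) - 'X : {poly D}) = (size l).+1.
    by rewrite size_polyDl ?size_polyXn // size_polyN size_polyX ltnS.
  have lc : lead_coef ('X^(size l) - 'X : {poly D}) = 1.
    by rewrite lead_coefDl ?lead_coefXn // size_polyN size_polyX size_polyXn.
  rewrite [LHS](all_roots_prod_XsubC (rs := rs)).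
  - by rewrite lc scale1r.
  - by rewrite sp -(perm_size prs).
  - apply/allP => z; rewrite -(perm_mem prs) => zl.
    by rewrite /root hornerD hornerN hornerXn hornerX lQ // subrr.
  apply: comm_uniq_roots => //; first by rewrite -(perm_uniq prs).
  by move=> y z; rewrite -!(perm_mem prs) => yl zl; apply: cL; apply: inL.
have : foldr (sylvester s) x rs = 0.
  rewrite -sylvester_prod -Xprod mulrBl -commr_polyXn -commr_polyX hornerD hornerN.
  by rewrite hornerCM hornerCM hornerXn hornerX lQ // subrr.
rewrite foldr_rcons; set x' := sylvester s s x => E.
have Kl v z : K v -> z \in rem s l -> K (sylvester s z v).
  move=> Kv /mem_rem zl; apply: dsB => //; apply: dsM => //.
  by apply: LK; apply: inL.
have Kx' : K x' by apply: dsB => //; apply: dsM.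
have x'0 : x' != 0 by rewrite subr_eq0; apply/eqP => e; apply: sx.
have [v [z [Kv v0 zrs Ev]]] := sylvester_eigen Kl Kx' x'0 E.
move: zrs; rewrite mem_rem_uniq // !inE => /andP[zs zl].
have cz : cj v s = z by rewrite /cj Ev mulrK ?hdiv.
have [PV [hPV PV0 Pv]] := alg v Kv.
have hLv y : L y -> L (cj v y).
  move=> [c hc ->]; rewrite (big_morph (cj v) (cjD v) (cj0 v)).
  apply: ds_sum => // i; rewrite cjM // cjX // cz center_cj //.
  by apply: dsM => //; [apply: FL|apply: dsX => //; apply: inL].
have hPL : coefs_in L PV by move=> i; apply: FL.
have := finite_normalized_comm hdiv fL hL v0 hLv (span_root hdiv hL hPL PV0 Pv) Ls.
rewrite Ev => /(div_mulIf hdiv v0) => Z.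
by rewrite Z eqxx in zs.
Qed.
End Jacobson.

(** * Subnormal subgroups and the fields that they normalize *)

Section SubnormalDepth.
Variable A : pzRingType.
Implicit Types G H : set A.

(** The recursion removes the smallest group of the chain, so that inductions
on the depth pass from [G] to the next larger group. *)
Fixpoint subnormal_depth r G : Prop :=
  if r is r'.+1 then exists H, [/\ subnormal_depth r' H, is_subgroup G & is_normal G H]
  else G = unit_group A.

Lemma subnormal_depthP G : is_subnormal G (unit_group A) -> exists r, subnormal_depth r G.
Proof.
move=> [r [chain [<- cr csub cnorm]]].
suff H k : (k <= r)%N -> subnormal_depth k (chain (r - k)%N).
  by exists r; have := H r (leqnn r); rewrite subnn.
elim: k => [|k IH] lt /=; first by rewrite subn0.
exists (chain (r - k)%N); split; [exact: IH (ltnW lt) | by apply: csub; lia |].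
by have := cnorm (r - k.+1)%N; rewrite -subSn // subSS; apply; lia.
Qed.

Lemma unit_group_is_subgroup : is_subgroup (unit_group A).
Proof.
split=> //; first by exists 1; split; rewrite mulr1.
- move=> x y [x' [xx' x'x]] [y' [yy' y'y]]; exists (y' * x'); split.
    by rewrite mulrA -[x * y * y']mulrA yy' mulr1.
  by rewrite mulrA -[y' * x' * x]mulrA x'x mulr1.
- by move=> x y _ [xy yx]; exists x.
Qed.

Lemma subnormal_subgroup r G : subnormal_depth r G -> is_subgroup G.
Proof. by case: r => [->|r [H []]] //; apply: unit_group_is_subgroup. Qed.

End SubnormalDepth.

Section SubnormalCentralizer.
Variable D : unitRingType.
Hypothesis hdiv : forall x : D, x != 0 -> x \is a GRing.unit.
Implicit Types (x y z g h t : D) (K L X T G H : set D) (P Q R : {poly D}).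

Lemma unit_group_neq0 x : unit_group D x <-> x != 0.
Proof.
split=> [[y [xy _]]|x0].
  by apply/eqP => x0; move/eqP: xy; rewrite x0 mul0r eq_sym oner_eq0.
by exists x^-1; split; rewrite ?divrr ?mulVr ?hdiv.
Qed.

Lemma inversesV x : x != 0 -> inverses x x^-1.
Proof. by move=> x0; split; rewrite ?divrr ?mulVr ?hdiv. Qed.

Section Subgroup.
Variable G : set D.
Hypothesis hG : is_subgroup G.
Lemma sg_neq0 x : G x -> x != 0.
Proof. by case: hG => H _ _ _ /H /unit_group_neq0. Qed.
Lemma sg1 : G 1. Proof. by case: hG. Qed.
Lemma sgM x y : G x -> G y -> G (x * y).
Proof. by case: hG => _ _ H _; apply: H. Qed.
Lemma sgV x : G x -> G x^-1.
Proof.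
by move=> Gx; case: hG => _ _ _ H; apply: (H x) => //; apply/inversesV/sg_neq0.
Qed.
Lemma sg_cj g x : G g -> G x -> G (cj g x).
Proof. by move=> Gg Gx; apply: sgM; [apply: sgM|apply: sgV]. Qed.
End Subgroup.

Lemma normal_cj G H g x : is_normal G H -> g != 0 -> H g -> G x -> G (cj g x).
Proof. by move=> [_ hn] g0 Hg Gx; apply: hn => //; apply: inversesV. Qed.

(** Each commutator with an element of [G] goes one step down the chain. *)
Lemma gcomms_subnormal r G x gs : subnormal_depth r G -> x != 0 ->
  (forall g, g \in gs -> G g) -> size gs = r -> G (gcomms x gs).
Proof.
elim: r G gs => [|r IH] G gs /=.
  by move=> -> x0 _ /eqP; rewrite size_eq0 => /eqP ->; apply/unit_group_neq0.
move=> [H [snH sgG GH]] x0; elim/last_ind: gs => [//|gs g _] hgs; rewrite size_rcons => -[sz].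
have hgs' g' : g' \in gs -> G g' by move=> g'gs; apply: hgs; rewrite mem_rcons in_cons g'gs orbT.
have Gg : G g by apply: hgs; rewrite mem_rcons mem_head.
have g0 := sg_neq0 sgG Gg.
have Hc : H (gcomms x gs) by apply: IH => // g' /hgs'; apply: GH.1.
have c0 := sg_neq0 (subnormal_subgroup snH) Hc.
rewrite /gcomms foldl_rcons -/(gcomms x gs) gcommE //.
by apply: (sgM sgG); [apply: (normal_cj GH)|apply: (sgV sgG)].
Qed.

Lemma iter_gcomm_subnormal r G g x : subnormal_depth r G -> x != 0 -> G g ->
  G (iter r (gcomm g) x).
Proof.
move=> snG x0 Gg; have := gcomms_nseq g x r [::]; rewrite cats0 /= => <-.
by apply: (gcomms_subnormal snG) => //; [move=> g' /nseqP[->]|rewrite size_nseq].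
Qed.

(** Throughout this section [L] is a commutative field, normalized by [h] and
not centralized by it. *)
Section NormalizedField.
Variables (L : set D) (h : D).
Hypotheses (hL : divsubring L) (cL : forall x y, L x -> L y -> x * y = y * x).
Hypotheses (h0 : h != 0) (Lh : forall x, L x -> L (cj h x))
  (Lh' : forall x, L x -> L (cj h^-1 x)).
Variable l0 : D.
Hypotheses (Ll0 : L l0) (hl0 : h * l0 <> l0 * h).

(** The linear principle applies to [1 + l h t] in two ways.  If the powers of
[h] are independent over [L], the ring [L[h]] is graded and [t = 1] suffices.
Otherwise some power of [h] centralizes [L], and [L] is infinite because [L[h]]
is not commutative, so the elements of [L] fixed by [h] are infinitely many
parameters that commute with [L] and [h]. *)
Lemma field_linear_principle l gs : L l ->
  (forall g, g \in gs -> g != 0 /\ (g = h \/ L g)) ->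
  (forall x, x != 0 -> gcomms x gs = 1) -> deltas (l * h) gs = 0.
Proof.
move=> Ll hgs Hgs.
have [trans|] := pselect (forall P, coefs_in L P -> P != 0 -> P.[h] != 0).
  have gr := skew_graded hdiv hL h0 Lh Lh'.
  have hn i : h ^+ i != 0 by apply: div_expf_neq0.
  have V0 : skew_component L h 0 1 by exists 1; [apply: ds1|rewrite mulr1].
  apply: (@linear_principle _ hdiv _ _ gr [set 1] _ _ _ gs 1) => //.
  - by move=> t i x -> _; rewrite mul1r mulr1.
  - move=> R hR R0; exists 1 => //.
    have hc i : L (R`_i * h ^- i).
      by have [m Lm <-] := hR i; rewrite mulrK ?hdiv.
    pose P : {poly D} := \poly_(i < size R) (R`_i * h ^- i).
    have <- : P.[h] = R.[1].
      rewrite horner_poly horner_coef; apply: eq_bigr => i _.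
      by rewrite expr1n mulr1 mulrVK ?hdiv.
    apply: trans.
      by move=> i; rewrite coef_poly; case: ifP => _ //; apply: ds0.
    apply: contraNneq R0 => P0; apply/eqP/polyP => i; rewrite coef0.
    have [lt|le] := ltnP i (size R); last by rewrite nth_default.
    have /(congr1 (fun p : {poly D} => p`_i)) := P0; rewrite coef_poly lt coef0.
    by move=> /(div_mulf_eq0 hdiv)[//|/eqP]; rewrite (negPf (div_invr_neq0 hdiv (hn i))).
  - by exists l => //; rewrite expr1.
  - move=> g /hgs[g0 hg]; split=> // [i _ [m Lm <-]|t ->]; last by rewrite mulr1 mul1r.
    case: hg => [->|Lg].
      exists (cj h m); first exact: Lh.
      by rewrite cjM // cjX // [cj h h]cj_fix.
    exists (g * m * cj (h ^+ i) g^-1).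
      apply: dsM => //; first exact: dsM.
      by apply: cj_expr_stable => //; apply: dsV.
    by rewrite -[LHS]mulrA cj_mulr // /cj !mulrA.
  by move=> t _; apply: Hgs.
move=> ntrans; have [P [hP P0 Ph]] : exists P, [/\ coefs_in L P, P != 0 & P.[h] = 0].
  apply: contrapT => H; case: ntrans => P hP P0; apply/eqP => Ph.
  by apply: H; exists P.
have [n n0 hn] := finite_order hdiv hL cL h0 Lh hP P0 Ph.
have iL : ~ finite_set L.
  move=> fL; apply: hl0.
  exact: (finite_normalized_comm hdiv fL hL h0 Lh (span_root hdiv hL hP P0 Ph) Ll0).
have := infinite_fixed hdiv hL cL h0 Lh n0 hn iL; set C := [set l | _] => iC.
have hB := centralizer_divsubring hdiv C.
have LB x : L x -> centralizer C x by move=> Lx c [Lc _]; apply: cL.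
have hB' : centralizer C h by move=> c [_ ->].
have Tc : forall t (i : nat) x, C t -> centralizer C x -> t * x = x * t.
  by move=> t _ x Ct Bx; rewrite Bx.
have Ts R : homog (fun=> centralizer C) R -> R != 0 -> exists2 t, C t & R.[t] != 0.
  by move=> _ R0; apply: infinite_nonroot => // x y [Lx _] [Ly _]; apply: cL.
apply: (linear_principle hdiv (constant_graded hB) Tc Ts (c := 1)).
- exact: (dsM hB (LB _ Ll) hB').
- exact: (ds1 hB).
- move=> g /hgs[g0 hg]; have Bg : centralizer C g by case: hg => [->//|/LB].
  by split=> // _ x Bx; apply: (ds_cj hB).
by move=> t _; apply: Hgs.
Qed.

Lemma delta_mulr_field b m : L b -> b != 0 -> L m ->
  delta b (m * h) = m * (1 - gcomm h b) * h.
Proof.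
move=> Lb b0 Lm; rewrite mulrBr mulr1 mulrBl /delta; congr (_ - _).
by rewrite /gcomm -cjV // -[RHS]mulrA -[b * _ * h]mulrA cj_mulr // /cj !mulrA (cL Lb Lm).
Qed.

Lemma iter_delta_mulr m n : iter n (delta h) (m * h) = iter n (delta h) m * h.
Proof.
elim: n => //= n ->; rewrite {1}/delta cjM // [cj h h]cj_fix //.
by rewrite -mulrBl.
Qed.

(** For [g] in [H] the word [[x, g, .., g, l0, l0]] with [r] letters [g] is
trivial: its part without the letters [l0] is in [H], so it normalizes [L], and
[L] is commutative.  With [g = h] the linear principle makes [1 - Ad h]
nilpotent on [L], which yields [y] in [L] with [h y h^-1 = y + 1].  Then
[a = [y, h, .., h]] is in [H] and in [L], and the word with [g = a] shows that
[a] commutes with [h], so the next commutator of [y] with [h] is [1]. *)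
Lemma no_normalized_field r H : subnormal_depth r H -> H h ->
  (forall x y, H x -> L y -> L (cj x y)) -> False.
Proof.
move=> snH Hh HL; have sgH := subnormal_subgroup snH.
have l00 : l0 != 0 by apply/eqP => E; apply: hl0; rewrite E mulr0 mul0r.
have Lc b : L b -> b != 0 -> L (1 - gcomm h b).
  move=> Lb b0; apply: dsB => //; first exact: ds1.
  by apply: ds_gcomm => //; apply: Lh.
pose e := 1 - gcomm h l0.
have Le : L e by apply: Lc.
have e0 : e != 0.
  apply/eqP => /eqP; rewrite subr_eq0 eq_sym => /eqP E; apply: hl0.
  exact: gcomm_eq1 E.
have word g x : H g -> g != 0 -> x != 0 -> gcomms x (nseq r g ++ [:: l0; l0]) = 1.
  move=> Hg g0 x0; rewrite gcomms_nseq /=.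
  have Hc := iter_gcomm_subnormal snH x0 Hg; set c := iter r _ x in Hc *.
  have c0 := sg_neq0 sgH Hc.
  have Lw : L (gcomm l0 c).
    by rewrite gcommE //; apply: dsM => //; [apply: HL|apply: dsV].
  by apply: gcomm_id => //; [apply: gcomm_neq0|apply: cL].
have kill m : L m -> deltas (m * h) [:: l0; l0] = m * e * e * h.
  move=> Lm /=; rewrite delta_mulr_field // delta_mulr_field // -/e.
  exact: dsM.
have gsP g : g != 0 -> g = h \/ L g ->
    forall g', g' \in nseq r g ++ [:: l0; l0] -> g' != 0 /\ (g' = h \/ L g').
  move=> g0 hg g'; rewrite mem_cat => /orP[/nseqP[-> _]//|].
  by rewrite !inE => /orP[]/eqP ->; split=> //; right.
have Lit n z : L z -> L (iter n (delta h) z).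
  by move=> Lz; elim: n => //= n IH; apply: ds_delta => //; apply: Lh.
have nil l : L l -> iter r (delta h) l = 0.
  move=> Ll.
  have := field_linear_principle Ll (gsP h h0 (or_introl erefl)) (fun x => word h x Hh h0).
  rewrite deltas_nseq iter_delta_mulr kill; last exact: Lit.
  move=> /(div_mulf_eq0 hdiv)[|/eqP]; last by rewrite (negPf h0).
  move=> /(div_mulf_eq0 hdiv)[|/eqP]; last by rewrite (negPf e0).
  by move=> /(div_mulf_eq0 hdiv)[//|/eqP]; rewrite (negPf e0).
have [|[y Ly hy] [p pp p0]] := unipotent_shift hdiv hL h0 Lh nil.
  by exists l0 => //; apply/eqP => /(delta_eq0 hdiv h0).
have [y0 _] := gcomm_shift_neq1 hdiv 0 h0 hy pp p0.
have Ha := iter_gcomm_subnormal snH y0 Hh; set a := iter r _ y in Ha.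
have a0 := sg_neq0 sgH Ha.
have La : L a.
  rewrite /a; elim: (r) => //= n IH; apply: ds_gcomm => //; exact: Lh.
have [_ /eqP] := gcomm_shift_neq1 hdiv r.+1 h0 hy pp p0; apply.
have := field_linear_principle (ds1 hL) (gsP a a0 (or_intror La)) (fun x => word a x Ha a0).
have ita n : iter n (delta a) (1 * h) = (1 - gcomm h a) ^+ n * h.
  elim: n => [|n IH] //; rewrite iterS IH delta_mulr_field //; last by apply: dsX => //; apply: Lc.
  by rewrite -exprSr.
rewrite deltas_nseq ita kill; last by apply: dsX => //; apply: Lc.
have [E _|nz] := eqVneq (1 - gcomm h a) 0.
  by apply/esym/eqP; rewrite -subr_eq0; apply/eqP.
move=> /(div_mulf_eq0 hdiv)[|/eqP]; last by rewrite (negPf h0).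
move=> /(div_mulf_eq0 hdiv)[|/eqP]; last by rewrite (negPf e0).
move=> /(div_mulf_eq0 hdiv)[/eqP|/eqP]; last by rewrite (negPf e0).
by rewrite (negPf (div_expf_neq0 hdiv r nz)).
Qed.
End NormalizedField.

End SubnormalCentralizer.

(** * Centralizers of subnormal subgroups *)

Section MainCentralizer.
Variable D : unitRingType.
Hypothesis hdiv : forall x : D, x != 0 -> x \is a GRing.unit.
Implicit Types (x y z g h t : D) (K L X T G H : set D) (P Q R : {poly D}).

(** Let [y] commute with [K] and let [b] be in [G].  If the center is finite, a
transcendental [t] in [K] commutes with [y] and [b], so that the commutator of
[1 + y t] with [b, .., b] lies in [G], whose elements are constants for the
polynomials over the centralizer of [K].  If the center is infinite, let
[x = s y]; the word [[1 + x t, b, .., b, k]] is trivial, so [k] commutes with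
[s * delta^r y], while it commutes with [delta^r y] and not with [s]. *)
Lemma iter_delta_double_centralizer r G K s k b :
  subnormal_depth r G -> K = centralizer G -> center D `<=` K ->
  (forall c, centralizer K c -> K c -> center D c) ->
  K s -> K k -> k * s <> s * k -> G b ->
  forall y, centralizer K y -> iter r (delta b) y = 0.
Proof.
move=> snG EK FK hZ Ks Kk ks Gb y K'y.
have sgG := subnormal_subgroup snG.
have b0 := sg_neq0 hdiv sgG Gb.
have hK : divsubring K by rewrite EK; apply: centralizer_divsubring.
have hK' := centralizer_divsubring hdiv K.
have GK' : G `<=` centralizer K by move=> g Gg z; rewrite EK => Kz; rewrite Kz.
have gsG : forall g, g \in nseq r b -> G g by move=> g /nseqP[->].
have dnil x : deltas x (nseq r b) = iter r (delta b) x.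
  by rewrite -[nseq r b]cats0 deltas_nseq.
have word x : x != 0 -> G (gcomms x (nseq r b)).
  by move=> x0; apply: (gcomms_subnormal hdiv snG) => //; rewrite size_nseq.
have [fF|iF] := pselect (finite_set (center D)).
  have [t Kt tr] := finite_center_transcendental hdiv fF hK FK Ks Kk (nesym ks).
  have Tc t' (i : nat) x : [set t] t' -> centralizer K x -> t' * x = x * t'.
    by move=> -> K'x; rewrite K'x.
  have Ts R : homog (fun=> centralizer K) R -> R != 0 -> exists2 t', [set t] t' & R.[t'] != 0.
    move=> hR R0; exists t => //; apply/eqP => Rt.
    have [|c K'c cc|P [hP P0 Pt]] := central_root hdiv hK' _ _ hR R0 Rt.
    - by move=> x K'x; rewrite K'x.
    - apply: hZ => //; rewrite EK => g Gg; apply: cc; exact: GK'.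
    by move: (tr P hP P0); rewrite Pt eqxx.
  have [t0|t0] := eqVneq (1 + y * t) 0.
    have y0 : y = 0.
      apply: contrapT => /eqP y0; have E : t = - y^-1.
        apply: (div_mulfI hdiv y0); rewrite mulrN divrr ?hdiv //.
        by apply/eqP; rewrite -addr_eq0 addrC t0.
      have cZ : center D t.
        by apply: hZ => //; rewrite E; exact: (dsN hK' (dsV hK' K'y)).
      have := tr ('X - t%:P) _ (monic_neq0 (monicXsubC t)).
      rewrite hornerXsubC subrr eqxx => K0; suff : false by [].
      apply: K0 => i; rewrite coefB coefX coefC.
      have hF := center_divsubring hdiv.
      apply: (dsB hF); first by case: eqP => _; [apply: ds1|apply: ds0].
      by case: eqP => _ //; apply: ds0.
    by rewrite y0 iter_delta0.
  rewrite -dnil; apply: (linear_principle hdiv (constant_graded hK') Tc Ts (c := gcomms (1 + y * t) (nseq r b))) => //.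
  - by apply: GK'; apply: word.
  - move=> g /gsG Gg; have K'g := GK' _ Gg; split; first exact: (sg_neq0 hdiv sgG).
      by move=> _ x K'x; apply: (ds_cj hK').
    by move=> _ ->; rewrite K'g.
  - by move=> _ ->.
have all_ds : divsubring [set: D] by [].
have Tc t (i : nat) x : center D t -> [set: D] x -> t * x = x * t by move=> ct _; apply: ct.
have Ts R : homog (fun=> [set: D]) R -> R != 0 -> exists2 t, center D t & R.[t] != 0.
  by move=> _ R0; apply: infinite_nonroot => // x z cx _; apply: cx.
have k0 : k != 0 by apply/eqP => E; apply: ks; rewrite E mul0r mulr0.
have cskb z : K z -> b * z = z * b by rewrite EK => Kz; rewrite Kz.
have kill x : delta k (iter r (delta b) x) = 0.
  have := @linear_principle D hdiv (fun=> [set: D]) 1 (constant_graded all_ds) (center D) Tc Ts x (rcons (nseq r b) k) 1.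
  rewrite /deltas foldl_rcons -/(deltas x (nseq r b)) dnil; apply => //.
    move=> g; rewrite mem_rcons inE => /orP[/eqP->|/gsG Gg].
      by split=> [|//|z ct]; rewrite ?ct.
    by split=> [|//|z ct]; rewrite ?ct //; exact: (sg_neq0 hdiv sgG).
  move=> t _ x0; rewrite /gcomms foldl_rcons -/(gcomms _ (nseq r b)).
  have Gw := word _ x0; apply: gcomm_id => //; first exact: (sg_neq0 hdiv sgG).
  by move: Kk; rewrite EK => ->.
have itK' z n : centralizer K z -> centralizer K (iter n (delta b) z).
  move=> K'z; elim: n => //= n IH; apply: (ds_delta hK') => //.
  by apply: (ds_cj hK') => //; apply: GK'.
have its n z : iter n (delta b) (s * z) = s * iter n (delta b) z.
  elim: n => //= n ->; rewrite {1}/delta cjM // [cj b s]cj_fix //; last exact: cskb.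
  by rewrite -mulrBr.
have := kill (s * y); rewrite its => /(delta_eq0 hdiv k0).
rewrite -mulrA (itK' y r K'y k Kk) !mulrA => E.
have [//|nz] := eqVneq (iter r (delta b) y) 0.
by case: ks; apply: (div_mulIf hdiv nz).
Qed.

(** Here [K] is the centralizer of [G], [K'] that of [K], and [H] the next group
of the chain; [H] normalizes both [K] and [K'], and only the center commutes
with [H].  If the intersection of [K] and [K'] is not central, it is a
normalized field that cannot exist.  Otherwise conjugation by any element of
[G] is unipotent on [K']. *)
Theorem subnormal_centralizer r G a s : subnormal_depth r G -> G a -> ~ center D a ->
  centralizer G s -> center D s.
Proof.
elim: r G a s => [|r IH] G a s snG Ga na Gs.
  move=> y; have [->|y0] := eqVneq y 0; first by rewrite mul0r mulr0.
  by apply: Gs; rewrite snG; apply/unit_group_neq0.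
have sgG := subnormal_subgroup snG.
have [H [snH _ GH]] := snG.
have sgH := subnormal_subgroup snH.
have CH z : centralizer H z -> center D z by apply: (IH H a) => //; apply: GH.1.
apply: contrapT => ns.
pose K := centralizer G; pose K' := centralizer K.
have hK : divsubring K := centralizer_divsubring hdiv G.
have hK' : divsubring K' := centralizer_divsubring hdiv K.
have FK : center D `<=` K by move=> c cc g _; apply: cc.
have GK' : G `<=` K' by move=> g Gg z Kz; rewrite Kz.
have HK h x : H h -> K x -> K (cj h x).
  move=> Hh; have h0 := sg_neq0 hdiv sgH Hh; apply: centralizer_cj => // g Gg.
  by apply: (normal_cj hdiv GH) => //; [apply: div_invr_neq0|apply: (sgV hdiv sgH)].
have HK' h x : H h -> K' x -> K' (cj h x).
  move=> Hh; have h0 := sg_neq0 hdiv sgH Hh; apply: centralizer_cj => // z Kz.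
  by apply: HK => //; apply: (sgV hdiv sgH).
have [hZ|nZ] := pselect (forall c, K' c -> K c -> center D c); last first.
  have [l0 [K'l Kl nl]] : exists l0, [/\ K' l0, K l0 & ~ center D l0].
    apply: contrapT => N; apply: nZ => c K'c Kc; apply: contrapT => nc.
    by apply: N; exists c.
  have [h Hh hl] : exists2 h, H h & h * l0 <> l0 * h.
    apply: contrapT => N; apply: nl; apply: CH => h Hh.
    by apply: contrapT => e; apply: N; exists h => // e'; apply: e.
  have h0 := sg_neq0 hdiv sgH Hh.
  have hL : divsubring (K `&` K').
    split.
    - by split; [apply: (ds1 hK)|apply: (ds1 hK')].
    - by move=> x y [? ?] [? ?]; split; [apply: (dsB hK)|apply: (dsB hK')].
    - by move=> x y [? ?] [? ?]; split; [apply: (dsM hK)|apply: (dsM hK')].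
    - by move=> x [? ?]; split; [apply: (dsV hK)|apply: (dsV hK')].
  have HL h' x : H h' -> (K `&` K') x -> (K `&` K') (cj h' x).
    by move=> Hh' [Kx K'x]; split; [apply: HK|apply: HK'].
  apply: (@no_normalized_field _ hdiv _ h hL _ h0 _ _ l0 _ hl r H) => //.
  - by move=> x y [Kx _] [_ K'y]; rewrite K'y.
  - by move=> x; apply: HL.
  - by move=> x; apply: HL; apply: (sgV hdiv sgH).
have [k Kk ks] : exists2 k, K k & k * s <> s * k.
  apply: contrapT => N; apply: ns; apply: hZ => // k Kk.
  by apply: contrapT => e; apply: N; exists k => // e'; apply: e.
have nil b : G b -> forall y, K' y -> iter r.+1 (delta b) y = 0.
  by move=> Gb; apply: (iter_delta_double_centralizer snG (erefl _) FK hZ Gs Kk ks).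
have a0 := sg_neq0 hdiv sgG Ga.
have aK' x : K' x -> K' (cj a x) by move=> K'x; exact: (ds_cj hK' (GK' _ Ga) K'x).
have [g Gg ag] : exists2 g, G g & a * g <> g * a.
  apply: contrapT => N; apply: na; apply: hZ; first exact: GK'.
  by move=> g Gg; apply: contrapT => e; apply: N; exists g.
have [|[y K'y hy] [p pp p0]] := unipotent_shift hdiv hK' a0 aK' (nil a Ga).
  by exists g; [apply: GK'|apply/eqP => /(delta_eq0 hdiv a0)].
have [y0 _] := gcomm_shift_neq1 hdiv 0 a0 hy pp p0.
have Gw := iter_gcomm_subnormal hdiv snG y0 Ga; set w := iter r.+1 _ y in Gw.
have w0 := sg_neq0 hdiv sgG Gw.
(* [Y] is commutative, contains all commutators of [y] with [a], and makes
[rho], the commutator of [w] with [a], commute with [w].  Thus [Ad w] sends [a]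
to [rho a] and fixes [rho], and nilpotency on [a] forces [rho = 1]. *)
pose Y := centralizer (centralizer [set y]).
have hY : divsubring Y := centralizer_divsubring hdiv _.
have Yy : Y y by move=> x hx; rewrite hx.
have Ycomm u v : Y u -> Y v -> u * v = v * u.
  by move=> Yu Yv; apply: Yu => _ ->; rewrite Yv // => _ ->.
have Ya u : Y u -> Y (cj a u).
  apply: centralizer_cj => // x hx _ ->.
  have hx' := hx y erefl.
  rewrite -[y](cjK hdiv y a0) hy cj_comm ?div_invr_neq0 //.
  by rewrite mulrDr mulrDl hx' mulr1 mul1r.
have Yw n : Y (iter n (gcomm a) y).
  by elim: n => //= n IHn; exact: (ds_gcomm hY IHn (Ya _ IHn)).
pose rho := gcomm a w.
have [_ /eqP] := gcomm_shift_neq1 hdiv r.+2 a0 hy pp p0; apply.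
rewrite iterS -/w -/rho.
have Yrho : Y rho by exact: (ds_gcomm hY (Yw r.+1) (Ya _ (Yw r.+1))).
have cwa : cj w a = rho * a.
  by rewrite /rho gcommE // /cj mulrVK ?hdiv.
have it n : iter n (delta w) a = (1 - rho) ^+ n * a.
  elim: n => [|n IHn]; first by rewrite mul1r.
  rewrite iterS IHn /delta cjM // cwa [cj w _]cj_fix //; last first.
    by apply: Ycomm; [apply: Yw|apply: (dsX hY); apply: (dsB hY (ds1 hY))].
  by rewrite mulrA -mulrBl exprSr mulrBr mulr1.
have := nil w Gw a (GK' _ Ga); rewrite it => /(div_mulf_eq0 hdiv)[E|/eqP]; last by rewrite (negPf a0).
apply: contrapT => nrho; have nz : 1 - rho != 0.
  by rewrite subr_eq0 eq_sym; apply/eqP.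
by move/eqP: E; rewrite (negPf (div_expf_neq0 hdiv _ nz)).
Qed.

Lemma inverses_inv x y : x != 0 -> inverses x y -> y = x^-1.
Proof. by move=> x0 [xy _]; apply: (div_mulfI hdiv x0); rewrite xy divrr ?hdiv. Qed.

Lemma gcomm_mul g z : g != 0 -> z != 0 -> gcomm g z * cj g z = z.
Proof. by move=> g0 z0; rewrite /gcomm mulrVK ?hdiv ?cj_neq0. Qed.

Lemma cj_gcomm s g x : s != 0 -> g != 0 -> cj s (gcomm g x) = gcomm (cj s g) (cj s x).
Proof.
move=> s0 g0; rewrite /gcomm cjM // cjV //; congr (_ * _^-1).
by rewrite {2 3}/cj !cjM // cjV.
Qed.

Lemma gcomm_central c d g x : center D c -> center D d -> c != 0 -> d != 0 ->
  g != 0 -> x != 0 -> gcomm (d * g) (c * x) = gcomm g x.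
Proof.
move=> cc cd c0 d0 g0 x0; rewrite /gcomm -[cj (d * g) _]cj_cj //.
have dcj y : cj d y = y by apply: cj_fix.
have gc : cj g c = c by apply: cj_fix => //; rewrite cc.
rewrite dcj cjM // gc invrM ?hdiv ?cj_neq0 // [c * x]cc -mulrA; congr (_ * _).
by rewrite mulrA cc mulrK ?hdiv.
Qed.

(** The centralizer of [s] in [G] is normal in [G], so it is subnormal, and [s]
commutes with it.  If it is contained in the center, then so is the derived
group of [G], because [s] commutes with commutators.  Then [a] may play the role
of [s], and the centralizer of [a] in [G] contains [a]. *)
Theorem subnormal_centralizer_mod r G a s : subnormal_depth r G -> G a -> ~ center D a ->
  s != 0 -> (forall g, G g -> center D (gcomm g s)) -> center D s.
Proof.
move=> snG Ga na s0 hs.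
have sgG := subnormal_subgroup snG.
have G0 g : G g -> g != 0 by apply: (sg_neq0 hdiv sgG).
have ker z : z != 0 -> (forall g, G g -> center D (gcomm g z)) ->
    subnormal_depth r.+1 [set g | G g /\ z * g = g * z].
  move=> z0 Gz; exists G; split=> //.
    split.
    - by move=> g [Gg _]; apply/(unit_group_neq0 hdiv); apply: G0.
    - by split; [apply: (sg1 sgG)|rewrite mulr1 mul1r].
    - move=> x y [Gx zx] [Gy zy]; split; first exact: (sgM sgG).
      by rewrite mulrA zx -mulrA zy mulrA.
    - move=> x y [Gx zx] /(inverses_inv (G0 _ Gx)) ->; split; first exact: (sgV hdiv sgG).
      have hx : centralizer [set z] x by move=> _ ->.
      by rewrite (dsV (centralizer_divsubring hdiv [set z]) hx).
  split=> [g []//|k k' g Gk /(inverses_inv (G0 _ Gk)) -> [Gg zg]].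
  have k0 := G0 _ Gk; rewrite -/(cj k g); split; first exact: (sg_cj hdiv sgG).
  have ck := Gz k Gk; rewrite -(gcomm_mul k0 z0); set c := gcomm k z in ck *.
  rewrite -[LHS]mulrA (cj_comm hdiv k0 zg) [LHS]mulrA [RHS]mulrA.
  by congr (_ * _); apply: ck.
have [[b [[Gb sb] nb]]|N] := pselect (exists b, (G b /\ s * b = b * s) /\ ~ center D b).
  exact: (subnormal_centralizer (ker s s0 hs) (conj Gb sb) nb (fun g hg => hg.2)).
have a0 := G0 _ Ga.
have Gcs g : G g -> center D (gcomm g a).
  move=> Gg; have g0 := G0 _ Gg; apply: contrapT => nc; apply: N; exists (gcomm g a).
  split=> //; split.
    by rewrite gcommE //; apply: (sgM sgG); [apply: (sg_cj hdiv sgG)|apply: (sgV hdiv sgG)].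
  apply: cj_fixE => //.
  have cjs x : G x -> exists2 c, center D c /\ c != 0 & cj s x = c * x.
    move=> Gx; have x0 := G0 _ Gx; exists (gcomm x s).
      by split; [apply: hs|apply: gcomm_neq0].
    by rewrite gcommE // /cj [in RHS]mulrVK ?hdiv.
  have [c [cc c0] Ec] := cjs a Ga; have [d [cd d0] Ed] := cjs g Gg.
  by rewrite cj_gcomm // Ec Ed gcomm_central.
case: (na); have Na : G a /\ a * a = a * a by [].
exact: (subnormal_centralizer (ker a a0 Gcs) Na na (fun g hg => hg.2)).
Qed.
End MainCentralizer.

(** * Involutions of division rings *)

Section InvolutionBasics.
Variables (A : pzRingType) (star : A -> A).
Hypothesis hstar : is_involution star.
Lemma starD x y : star (x + y) = star x + star y. Proof. by case: hstar. Qed.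
Lemma starM x y : star (x * y) = star y * star x. Proof. by case: hstar. Qed.
Lemma starK x : star (star x) = x. Proof. by case: hstar. Qed.
Lemma star0 : star 0 = 0.
Proof. by apply: (addrI (star 0)); rewrite -starD !addr0. Qed.
Lemma starN x : star (- x) = - star x.
Proof. by apply/eqP; rewrite -addr_eq0 -starD addrC subrr star0. Qed.
Lemma starB x y : star (x - y) = star x - star y.
Proof. by rewrite starD starN. Qed.
Lemma star1 : star 1 = 1.
Proof. by have := starM (star 1) 1; rewrite mulr1 starK mulr1. Qed.
End InvolutionBasics.

Section DivisionInvolution.
Variable D : unitRingType.
Hypothesis hdiv : forall x : D, x != 0 -> x \is a GRing.unit.
Variable star : D -> D.
Hypothesis hstar : is_involution star.
Hypothesis hfirst : first_kind star.
Implicit Types (x y z g h t : D) (G H : set D).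

Let starD' x y : star (x + y) = star x + star y := starD hstar x y.
Let starM' x y : star (x * y) = star y * star x := starM hstar x y.
Let starK' x : star (star x) = x := starK hstar x.
Let star0' : star 0 = 0 := star0 hstar.
Let star1' : star 1 = 1 := star1 hstar.

Lemma star_neq0 x : x != 0 -> star x != 0.
Proof. by apply: contraNneq => E; rewrite -(starK' x) E star0'. Qed.

Lemma starV x : x != 0 -> star x^-1 = (star x)^-1.
Proof.
move=> x0; apply: (div_mulIf hdiv (star_neq0 x0)).
by rewrite -starM' // divrr ?hdiv // star1' // mulVr ?hdiv // star_neq0.
Qed.

Let hF := center_divsubring hdiv.

(** If [c] and [d] are the norms of [x g x^-1] and [g], then the commutator of
[star x * x] with [g] is [c / d]. *)
Lemma norms_normal_step r G H a : subnormal_depth r.+1 G -> is_subgroup H ->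
  is_normal G H -> G a -> ~ center D a ->
  (forall g, G g -> center D (g * star g)) -> forall x, H x -> center D (x * star x).
Proof.
move=> snG sgH GH Ga na NG x Hx.
have sgG := subnormal_subgroup snG.
have x0 := sg_neq0 hdiv sgH Hx; have u0 := star_neq0 x0.
have s0 : star x * x != 0 by apply: div_mulf_neq0.
have cs : center D (star x * x).
  apply: (subnormal_centralizer_mod hdiv snG Ga na s0) => g Gg.
  have g0 := sg_neq0 hdiv sgG Gg.
  have Gy : G (cj x g) by apply: (normal_cj hdiv GH).
  have cy := NG _ Gy; have cg := NG _ Gg.
  have n0 : g * star g != 0 by apply: div_mulf_neq0 => //; apply: star_neq0.
  set c := cj x g * star (cj x g) in cy; set d := g * star g in cg n0.
  have Eg : star g = g^-1 * d by rewrite /d mulKr ?hdiv.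
  pose m := x * g * x^-1 * (star x)^-1 * g^-1.
  have Em : m * star x * d = c.
    by rewrite /c /m /cj !starM' starV // Eg -[g^-1 * d * _]mulrA cg !mulrA.
  have cm : center D (m * star x).
    have -> : m * star x = c * d^-1 by rewrite -Em mulrK ?hdiv.
    by apply: (dsM hF) => //; apply: (dsV hF).
  suff -> : gcomm g (star x * x) = m * star x by [].
  apply: (div_mulIf hdiv u0); rewrite cm gcommE // invrM ?hdiv // /m.
  by rewrite !mulrA.
have -> // : x * star x = star x * x.
by apply: (div_mulIf hdiv x0); rewrite -mulrA -cs.
Qed.

Lemma norms_subnormal r G a : subnormal_depth r G -> G a -> ~ center D a ->
  (forall g, G g -> center D (g * star g)) -> forall x, center D (x * star x).
Proof.
elim: r G => [|r IH] G snG Ga na NG x.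
  have [->|x0] := eqVneq x 0; first by rewrite mul0r; apply: (ds0 hF).
  by apply: NG; rewrite snG; apply/unit_group_neq0.
have [H [snH _ GH]] := snG.
have sgH := subnormal_subgroup snH.
apply: (IH H) => //; first by apply: GH.1.
exact: (norms_normal_step snG sgH GH Ga).
Qed.

(** Since [star x = t - x] commutes with [x], the traces [t] of [x] and [s] of
[x^-1] are related by [t = (x * star x) * s].  If [s = 0], then [star x = - x];
for [z] in [G] the traces [p] of [z x] and [q] of [z x^-1] satisfy [p = x^2 q],
so [x^2] is central, or [q = 0] and then [x^2] commutes with [z]. *)
Lemma traces_norms_subnormal r G a : subnormal_depth r G -> G a -> ~ center D a ->
  (forall g, G g -> center D (g + star g)) -> forall x, G x -> center D (x * star x).
Proof.
move=> snG Ga na TG x Gx; have sgG := subnormal_subgroup snG.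
have x0 := sg_neq0 hdiv sgG Gx.
have ct := TG _ Gx; set t := x + star x in ct.
have Eu : star x = t - x by rewrite /t addrC addKr.
have cu : x * star x = star x * x by rewrite Eu mulrBr mulrBl ct.
have cs := TG _ (sgV hdiv sgG Gx); set s := _ + _ in cs.
have Es : x * star x * s = t.
  rewrite /s starV // mulrDr {1}cu mulrK ?hdiv // mulrK ?hdiv ?star_neq0 //.
  by rewrite addrC.
have [s0|s0] := eqVneq s 0; last first.
  have -> : x * star x = t * s^-1 by rewrite -Es mulrK ?hdiv.
  by apply: (dsM hF) => //; apply: (dsV hF).
have t0 : t = 0 by rewrite -Es s0 mulr0.
rewrite Eu t0 sub0r mulrN; apply: (dsN hF).
apply: (subnormal_centralizer hdiv snG Ga na) => z Gz.
have cz := TG _ Gz; set tz := z + star z in cz.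
have Ez : star z = tz - z by rewrite /tz addrC addKr.
clearbody tz.
have cp := TG _ (sgM sgG Gz Gx); set p := _ + _ in cp.
have cq := TG _ (sgM sgG Gz (sgV hdiv sgG Gx)); set q := _ + _ in cq.
have Ep : p = z * x + x * z - x * tz.
  by rewrite /p starM' // Eu t0 sub0r Ez mulNr mulrBr opprB addrA.
have Eq : q = z * x^-1 + x^-1 * z - x^-1 * tz.
  by rewrite /q starM' // starV // Eu t0 sub0r Ez invrN mulNr mulrBr opprB addrA.
have pq : p = x * x * q.
  rewrite Ep -mulrA -cq mulrA Eq mulrBr mulrDr mulrBl mulrDl !mulVKr ?hdiv //.
  by rewrite mulrA mulrVK ?hdiv // [x * z + _]addrC cz.
have [q0|q0] := eqVneq q 0; last first.
  have -> : x * x = p * q^-1 by rewrite pq mulrK ?hdiv.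
  exact: (dsM hF cp (dsV hF cq)).
have p0 : p = 0 by rewrite pq q0 mulr0.
have E : z * x + x * z = x * tz by apply/eqP; rewrite -subr_eq0 -Ep p0.
have Exz : x * z = (tz - z) * x by rewrite mulrBl cz -E addrC addKr.
by rewrite -mulrA Exz mulrA mulrBr -E addrK -mulrA.
Qed.

Lemma norms_traces : (forall x, center D (x * star x)) -> forall x, center D (x + star x).
Proof.
move=> N x; have := N (1 + x); rewrite starD' // star1' // mulrDr mulr1 mulrDl mul1r.
move=> h; have -> : x + star x = (1 + x + (star x + x * star x)) - x * star x - 1.
  by rewrite addrA addrK -[1 + x + _]addrA [1 + _]addrC addrK.
by do 2?[apply: (dsB hF)] => //; apply: (ds1 hF).
Qed.

End DivisionInvolution.

(** * Division rings with central traces and norms *)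

Section Quaternion.
Variables (F : fieldType) (D : unitAlgType F).
Hypothesis hD : division_ring_with_center D.
Let hdiv : forall x : D, x != 0 -> x \is a GRing.unit := hD.1.
Variable star : D -> D.
Hypothesis hstar : is_involution star.
Hypothesis hfirst : first_kind star.
Hypothesis hT : forall x, center D (x + star x).
Hypothesis hN : forall x, center D (x * star x).
Implicit Types (x y z : D) (a b c : F).

Let starM' x y : star (x * y) = star y * star x := starM hstar x y.
Let hF := center_divsubring hdiv.

Lemma centerP x : center D x -> exists a, x = a%:A.
Proof. by rewrite hD.2 => -[a _ <-]; exists a. Qed.

Lemma center_scale a : center D a%:A.
Proof. by rewrite hD.2; exists a. Qed.

Variable a : D.
Hypothesis na : ~ center D a.

Lemma exists_nonsymmetric : exists u, star u <> u.
Proof.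
apply: contrapT => H; have sym x : star x = x by apply: contrapT => e; apply: H; exists x.
by apply: na => y; rewrite -[a * y]sym starM' !sym.
Qed.

Section Basis.
Variable u v : D.
Hypotheses (su : star u <> u) (uv : u * v <> v * u).
Let S : set D := centralizer [set u].
Let hS : divsubring S := centralizer_divsubring hdiv _.
Let Su : S u. Proof. by move=> _ ->. Qed.
Let SF x : center D x -> S x. Proof. by move=> cx y _; apply: cx. Qed.
Let t := u + star u.
Let e := u - star u.
Let e0 : e != 0. Proof. by rewrite subr_eq0; apply/eqP => E; apply: su. Qed.
Let Sstar : S (star u).
Proof.
have -> : star u = t - u by rewrite /t addrC addKr.
by apply: (dsB hS) => //; apply: SF; apply: hT.
Qed.
Let Se : S e. Proof. exact: (dsB hS Su Sstar). Qed.

(** The trace of [x u] shows that right multiplication by [u] is left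
multiplication by [star u], up to an element of [F(u)]. *)
Lemma mulr_semilinear x : exists p q,
  [/\ center D p, center D q & x * u = star u * x + (p - q * star u)].
Proof.
exists (x * u + star (x * u)), (x + star x); split=> //.
by rewrite hT mulrDr starM' opprD addrACA subrr addr0 [RHS]addrC subrK.
Qed.

(** If [x] commutes with [u], the previous lemma can be solved for [x], because
[e = u - star u] satisfies [e^2 = - N(e)] and is therefore invertible in the
span of [1] and [u]. *)
Lemma centralizer_span x : S x -> exists b c, x = b%:A + c *: u.
Proof.
move=> Sx; have [p [q [cp cq]]] := mulr_semilinear x.
rewrite (Sx u erefl) => /eqP; rewrite addrC -subr_eq -mulrBl -/e => /eqP E.
have cn : center D (e * star e) := hN e.
have se : star e = - e by rewrite /e starB // starK // opprB.
have ee0 : e * star e != 0 by rewrite se mulrN oppr_eq0; apply: (div_mulf_neq0 hdiv).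
have {E}E : x = star e * (p - q * star u) * (e * star e)^-1.
  rewrite -E -mulrA; apply: (div_mulIf hdiv ee0); rewrite -!mulrA mulVr ?hdiv // mulr1 -/e.
  by rewrite mulrA [star e * e](_ : _ = e * star e) ?cn // se mulNr mulrN.
have [p' Ep] := centerP cp; have [q' Eq] := centerP cq.
have [m Em] := centerP (dsV hF cn); have [tt Et] := centerP (hT u).
have [nn En] := centerP (hN u).
have sut : star u = tt%:A - u by rewrite -Et addrC addKr.
have uu : u * u = tt *: u - nn%:A.
  by rewrite -En sut mulrBr -scalerAr mulr1 opprB addrC subrK.
pose W y := exists b c, y = b%:A + c *: u.
have WD y z : W y -> W z -> W (y + z).
  move=> [b [c ->]] [b' [c' ->]]; exists (b + b'), (c + c').
  by rewrite !scalerDl addrACA.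
have WZ b y : W y -> W (b *: y).
  by move=> [b' [c' ->]]; exists (b * b'), (b * c'); rewrite scalerDr !scalerA.
have W1 : W 1 by exists 1, 0; rewrite scale1r scale0r addr0.
have Wu : W u by exists 0, 1; rewrite scale1r scale0r add0r.
have WN y : W y -> W (- y) by rewrite -scaleN1r; apply: WZ.
have Wuu : W (u * u) by rewrite uu; apply: WD; [apply: WZ|apply: WN; apply: WZ].
have WuM y : W y -> W (u * y).
  by move=> [b [c ->]]; rewrite mulrDr -!scalerAr mulr1; apply: WD; apply: WZ.
have WM y z : W y -> W z -> W (y * z).
  move=> [b [c ->]] Wz; rewrite mulrDl -!scalerAl mul1r.
  by apply: WD; apply: WZ => //; apply: WuM.
have Wsu : W (star u) by rewrite sut; apply: WD; [apply: WZ|apply: WN].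
have We : W (- e) := WN _ (WD _ _ Wu (WN _ Wsu)).
have Wl : W (p'%:A - q'%:A * star u).
  exact: (WD _ _ (WZ _ _ W1) (WN _ (WM _ _ (WZ _ _ W1) Wsu))).
by rewrite E Em Ep Eq se; exact: (WM _ _ (WM _ _ We Wl) (WZ _ _ W1)).
Qed.

(** Since [u <> star u], the error term of [mulr_semilinear] is absorbed by
translating [x] within [F(u)]. *)
Lemma twist x : exists2 l, S l & (x + l) * u = star u * (x + l).
Proof.
have [p [q [cp cq E]]] := mulr_semilinear x.
have Sl : S (p - q * star u) by apply: (dsB hS (SF cp)); apply: (dsM hS (SF cq) Sstar).
set l := p - _ in E Sl.
pose k := - (e^-1 * l); have Sk : S k by apply: (dsN hS); apply: (dsM hS (dsV hS Se) Sl).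
have El : l = (star u - u) * k by rewrite -opprB -/e mulNr mulrN opprK mulVKr ?hdiv.
have Ek : l + u * k = star u * k by rewrite [X in X + _]El mulrBl subrK.
clear El; clearbody k l; exists k => //.
by rewrite mulrDl E (Sk u erefl) mulrDr -[LHS]addrA Ek.
Qed.

(** Two elements that twist [u] into [star u] differ by a left factor that
commutes with [u]; apply this to translates of [x] and of [v]. *)
Lemma left_basis x : exists m n, [/\ S m, S n & x = m + n * v].
Proof.
have [l1 Sl1 E1] := twist x; have [l2 Sl2 E2] := twist v.
set x' := x + l1 in E1; set v' := v + l2 in E2.
have v'0 : v' != 0.
  rewrite addr_eq0; apply/eqP => E; apply: uv; rewrite E.
  by have -> := dsN hS Sl2 u erefl.
have Sm : S (x' * v'^-1).
  have h : centralizer [set star u] (x' * v'^-1).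
    move=> _ ->; rewrite mulrA -E1 -!mulrA; congr (_ * _).
    by apply: (div_mulIf hdiv v'0); rewrite -!mulrA mulVr ?hdiv // mulr1 -E2 mulKr ?hdiv.
  move=> _ ->; have -> : u = (u + star u) - star u by rewrite addrK.
  by rewrite mulrBr mulrBl hT (h _ erefl).
set m := _ * _ in Sm.
have Ex : x' = m * v' by rewrite /m mulrVK ?hdiv.
exists (m * l2 - l1), m; split=> //; first by apply: (dsB hS) => //; apply: (dsM hS).
by rewrite -[LHS](addrK l1) -/x' Ex /v' [m * _]mulrDr -addrA [RHS]addrC.
Qed.

Lemma span_in_centralizer b c : S (b%:A + c *: u).
Proof. by move=> _ ->; rewrite mulrDl mulrDr -!scalerAl -!scalerAr mul1r mulr1. Qed.

Lemma span_free b c : b%:A + c *: u = 0 -> b = 0 /\ c = 0.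
Proof.
move=> E; have c0 : c = 0.
  apply: contrapT => /eqP c0; apply: su.
  have Eu : u = (- (c^-1 * b))%:A.
    apply: (@scalerI _ _ c) => //; rewrite scalerA mulrN mulVKf //.
    by apply/eqP; rewrite scaleNr -addr_eq0 addrC E.
  by apply: hfirst; rewrite Eu; apply: center_scale.
split=> //; move: E; rewrite c0 scale0r addr0 => /eqP.
by rewrite scaler_eq0 oner_eq0 orbF => /eqP.
Qed.

Definition quaternion_coordinates (r : 'rV[F]_4) : D :=
  (r 0 (inord 0))%:A + r 0 (inord 1) *: u +
  ((r 0 (inord 2))%:A + r 0 (inord 3) *: u) * v.

Lemma quaternion_dimension : has_dimension D 4.
Proof.
pose phi := quaternion_coordinates.
have lin c b b' d d' :
    (c * b + b')%:A + (c * d + d') *: u = c *: (b%:A + d *: u) + (b'%:A + d' *: u).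
  by rewrite !scalerDl -!scalerA addrACA -scalerDr.
have philin : linear phi.
  move=> c r r'; rewrite /phi /quaternion_coordinates !mxE !lin.
  by rewrite mulrDl -scalerAl addrACA -scalerDr.
have phi0 r : phi r = 0 -> r = 0.
  rewrite /phi /quaternion_coordinates; set m := (X in X + _ * v); set n := (X in _ + X * v).
  move=> E; have Sm : S m by apply: span_in_centralizer.
  have Sn : S n by apply: span_in_centralizer.
  have n0 : n = 0.
    apply: contrapT => /eqP n0; apply: uv.
    have -> : v = - (n^-1 * m).
      apply: (div_mulfI hdiv n0); rewrite mulrN mulVKr ?hdiv //.
      by apply/eqP; rewrite -addr_eq0 addrC E.
    by have -> := dsN hS (dsM hS (dsV hS Sn) Sm) u erefl.
  move: E; rewrite n0 mul0r addr0 => /span_free[r0 r1].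
  have [r2 r3] := span_free n0.
  apply/rowP => i; rewrite mxE -[i]inord_val; case: i => -[|[|[|[|//]]]] /= _ //.
have phiinj : injective phi.
  move=> r r' E; apply/eqP; rewrite -subr_eq0; apply/eqP; apply: phi0.
  by rewrite addrC -scaleN1r philin E scaleN1r addNr.
have surj x : exists r, phi r = x.
  have [m [n [Sm Sn ->]]] := left_basis x.
  have [b [c ->]] := centralizer_span Sm; have [d [f ->]] := centralizer_span Sn.
  exists (\row_(i < 4) nth 0 [:: b; c; d; f] i).
  by rewrite /phi /quaternion_coordinates !mxE !inordK.
exists (fun x => sval (cid (surj x))).
  move=> c x y; apply: phiinj; rewrite philin.
  by case: cid => ? ->; case: cid => ? ->; case: cid => ? ->.
exists phi => [x|r]; first by case: cid.
by apply: phiinj; case: cid.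
Qed.

End Basis.

Theorem trace_norm_quaternion : quaternion_division_algebra D.
Proof.
split=> //; have [u su] := exists_nonsymmetric.
have [v uv] : exists v, u * v <> v * u.
  apply: contrapT => H; apply: su; apply: hfirst => v.
  by apply: contrapT => e; apply: H; exists v.
exact: (quaternion_dimension su uv).
Qed.

End Quaternion.

(** * Involutions of matrix rings *)

Section MatrixUnits.
Variables (D : nzRingType) (n : nat).
Implicit Types (i j k l : 'I_n) (a b : D) (x y : 'M[D]_n).

Definition munit i j a : 'M[D]_n := \matrix_(k, l) if (k == i) && (l == j) then a else 0.

Lemma munitE i j a k l : munit i j a k l = if (k == i) && (l == j) then a else 0.
Proof. by rewrite mxE. Qed.

Lemma mxmulE x y i j : (x * y) i j = \sum_k x i k * y k j.
Proof. by rewrite mxE. Qed.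

Lemma munit_mull i j a x k l : (munit i j a * x) k l = if k == i then a * x j l else 0.
Proof.
rewrite mxmulE; case: (eqVneq k i) => [->|ki].
  rewrite (bigD1 j) //= munitE !eqxx big1 ?addr0 // => m mj.
  by rewrite munitE (negPf mj) andbF mul0r.
by rewrite big1 // => m _; rewrite munitE (negPf ki) mul0r.
Qed.

Lemma munit_mulr i j a x k l : (x * munit i j a) k l = if l == j then x k i * a else 0.
Proof.
rewrite mxmulE; case: (eqVneq l j) => [->|lj].
  rewrite (bigD1 i) //= munitE !eqxx big1 ?addr0 // => m mi.
  by rewrite munitE (negPf mi) mulr0.
by rewrite big1 // => m _; rewrite munitE (negPf lj) andbF mulr0.
Qed.

Lemma munitM i j k l a b : munit i j a * munit k l b = if j == k then munit i l (a * b) else 0.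
Proof.
apply/matrixP => p q; rewrite munit_mull munitE.
case: (eqVneq j k) => [_|jk]; rewrite ?munitE ?mxE; case: eqP => //= _.
  by case: eqP; rewrite ?mulr0.
by rewrite mulr0.
Qed.

Lemma munitD i j a b : munit i j (a + b) = munit i j a + munit i j b.
Proof. by apply/matrixP => p q; rewrite !mxE; case: ifP => _ //; rewrite addr0. Qed.

Lemma munit0 i j : munit i j 0 = 0.
Proof. by apply/matrixP => p q; rewrite !mxE if_same. Qed.

Lemma munitN i j a : munit i j (- a) = - munit i j a.
Proof. by apply/matrixP => p q; rewrite !mxE; case: ifP => _ //; rewrite oppr0. Qed.

Lemma matrix_sum_munit x : x = \sum_i \sum_j munit i j (x i j).
Proof.
apply/matrixP => p q; rewrite summxE (bigD1 p) //= summxE (bigD1 q) //= !munitE !eqxx /=.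
rewrite big1 => [|j jq]; last by rewrite munitE eqxx /= eq_sym (negPf jq).
rewrite addr0 big1 ?addr0 // => i ip; rewrite summxE big1 // => j _.
by rewrite munitE eq_sym (negPf ip).
Qed.

Definition transv i j a : 'M[D]_n := 1 + munit i j a.

Lemma transv_mul i j a b : i != j -> transv i j a * transv i j b = transv i j (a + b).
Proof.
move=> ij; rewrite /transv mulrDl mul1r mulrDr mulr1 munitM eq_sym (negPf ij) addr0.
by rewrite munitD -addrA [X in _ + X]addrC.
Qed.

Lemma transv0 i j : transv i j 0 = 1. Proof. by rewrite /transv munit0 addr0. Qed.

Lemma transv_inverses i j a : i != j -> inverses (transv i j a) (transv i j (- a)).
Proof. by move=> ij; split; rewrite transv_mul // ?subrr ?addNr transv0. Qed.

End MatrixUnits.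

Section Symplectic.
Variables (F : fieldType) (D : unitAlgType F) (n : nat) (star : 'M[D]_n -> 'M[D]_n).
Hypothesis hD : division_ring_with_center D.
Hypothesis hstar : is_involution star.
Hypothesis n2 : (1 < n)%N.
Let hdiv : forall x : D, x != 0 -> x \is a GRing.unit := hD.1.
Hypothesis hT : forall i j a, i != j ->
  scalar_matrices D n (munit i j a + star (munit i j a)).
Implicit Types (i j k : 'I_n) (a b : D).

Let starM' x y : star (x * y) = star y * star x := starM hstar x y.

Lemma mx_mul_scalarE (x : 'M[D]_n) a i j : (x * a%:M) i j = x i j * a.
Proof.
rewrite mxmulE (bigD1 j) //= mxE eqxx mulr1n big1 ?addr0 // => k kj.
by rewrite mxE (negPf kj) mulr0n mulr0.
Qed.

Lemma scalar_mx_mulE (x : 'M[D]_n) a i j : (a%:M * x) i j = a * x i j.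
Proof.
rewrite mxmulE (bigD1 i) //= mxE eqxx mulr1n big1 ?addr0 // => k ki.
by rewrite mxE eq_sym (negPf ki) mulr0n mul0r.
Qed.

(** If [c] is the trace of [e = a e_ij], then [e^2 = 0] gives [(c - e)^2 = 0],
whose entry at [(i, i)] is [c^2]. *)
Lemma star_munit i j a : i != j -> star (munit i j a) = - munit i j a.
Proof.
move=> ij; have [c _ E] := hT a ij; set e := munit i j a in E *.
have es : star e = (c%:A)%:M - e by rewrite E addrC addKr.
have eii : e i i = 0 by rewrite munitE eqxx (negPf ij).
have : star (e * e) = 0 by rewrite munitM eq_sym (negPf ij) star0.
rewrite starM' es mulrBl => /matrixP/(_ i i).
have Sii : ((c%:A)%:M - e) i i = c%:A by rewrite !mxE eqxx mulr1n (negPf ij) andbF subr0.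
have Sji : ((c%:A)%:M - e) j i = 0 by rewrite !mxE eq_sym (negPf ij) mulr0n subr0.
rewrite mxE [X in _ + X]mxE scalar_mx_mulE munit_mull eqxx Sii Sji mulr0 subr0 mxE.
move=> /(div_mulf_eq0 hdiv) c0; have {}c0 : c%:A = 0 :> D by case: c0.
by rewrite c0 raddf0 sub0r.
Qed.

Lemma star_munit_diag i j a b : i != j -> star (munit i i (a * b)) = munit j j (b * a).
Proof.
move=> ij; have := munitM i j j i a b; rewrite eqxx => <-.
by rewrite starM' !star_munit // 1?eq_sym // mulrNN munitM eqxx.
Qed.

Lemma degree2 : n = 2%N.
Proof.
have [//|n3] : n = 2%N \/ (2 < n)%N by lia.
pose i : 'I_n := Ordinal (ltnW n2); pose j : 'I_n := Ordinal n2; pose k : 'I_n := Ordinal n3.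
have E1 := @star_munit_diag i j 1 1 isT; have E2 := @star_munit_diag i k 1 1 isT.
move: E1; rewrite E2 => /matrixP/(_ j j); rewrite !munitE /= mul1r => /eqP.
by rewrite eq_sym oner_eq0.
Qed.

Lemma base_commutative a b : a * b = b * a.
Proof.
pose i : 'I_n := Ordinal (ltnW n2); pose j : 'I_n := Ordinal n2.
have E1 := @star_munit_diag i j a b isT; have E2 := @star_munit_diag i j 1 (a * b) isT.
rewrite mul1r mulr1 in E2; move: E1; rewrite E2 => /matrixP/(_ j j).
by rewrite !munitE eqxx.
Qed.

Lemma base_field a : exists c : F, a = c%:A.
Proof.
have : center D a by move=> b; apply: base_commutative.
by rewrite hD.2 => -[c _ <-]; exists c.
Qed.

End Symplectic.

Lemma symplectic2_unique (D : nzRingType) (star : 'M[D]_2 -> 'M[D]_2) :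
  (forall x y, star (x + y) = star x + star y) ->
  (forall i j a, i != j -> star (munit i j a) = - munit i j a) ->
  (forall i j a, i != j -> star (munit i i a) = munit j j a) ->
  forall x, star x = symplectic2 x.
Proof.
move=> hadd hoff hdiag x.
have i01 : ord0 != ord_max :> 'I_2 by [].
have i10 : ord_max != ord0 :> 'I_2 by [].
have -> : x = munit 0 0 (x 0 0) + munit 0 ord_max (x 0 ord_max) +
    (munit ord_max 0 (x ord_max 0) + munit ord_max ord_max (x ord_max ord_max)).
  rewrite [LHS]matrix_sum_munit big_ord_recl big_ord1 !big_ord_recl !big_ord0 !addr0.
  by do ?[congr (_ + _)]; congr (munit _ _ (x _ _)); apply/val_inj.
rewrite !hadd (hdiag 0 ord_max) // (hdiag ord_max 0) // (hoff 0 ord_max) // (hoff ord_max 0) //.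
set a := x 0 0; set b := x 0 _; set c := x _ 0; set d := x ord_max ord_max.
apply/matrixP => -[[|[|//]] ?] -[[|[|//]] ?]; rewrite !mxE /=;
  by rewrite !(addr0, add0r, oppr0).
Qed.

Lemma ordinary_symplectic (F : fieldType) (D : unitAlgType F) (n : nat)
    (star : 'M[D]_n -> 'M[D]_n) :
  division_ring_with_center D -> is_involution star -> (1 < n)%N ->
  (forall i j a, i != j -> scalar_matrices D n (munit i j a + star (munit i j a))) ->
  [/\ n = 2%N, (forall x : D, exists a : F, x = a%:A) & is_ordinary_symplectic star].
Proof.
move=> hD hstar n2 hT; have E2 := degree2 hD hstar n2 hT.
have hb := base_field hD hstar n2 hT.
split=> //; exists E2; subst n => x; rewrite !castmx_id.
apply: symplectic2_unique => [y z|i j a ij|i j a ij]; first exact: (starD hstar).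
  exact: (star_munit hD hstar hT).
by rewrite -[a]mulr1 (star_munit_diag hD hstar hT a 1 ij) mul1r mulr1.
Qed.

Lemma symplectic_trace_norm (F : fieldType) (D : unitAlgType F) (n : nat)
    (star : 'M[D]_n -> 'M[D]_n) :
  n = 2%N -> (forall x : D, exists a : F, x = a%:A) -> is_ordinary_symplectic star ->
  forall x, scalar_matrices D n (x + star x) /\ scalar_matrices D n (x * star x).
Proof.
move=> n2 hb [e hs] x; subst n; have {}hs y : star y = symplectic2 y.
  by have := hs y; rewrite !castmx_id.
rewrite hs; have cD (a b : D) : a * b = b * a.
  by have [c ->] := hb a; rewrite -scalerAl -scalerAr mul1r mulr1.
have scalarP (c : D) : scalar_matrices D 2 c%:M by have [f ->] := hb c; exists f.
have cs (i : 'I_2) : i = 0 \/ i = ord_max.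
  by case: i => -[|[|//]] ?; [left|right]; apply/val_inj.
have r0 : rev_ord 0 = ord_max :> 'I_2 by apply/val_inj.
have r1 : rev_ord ord_max = 0 :> 'I_2 by apply/val_inj.
have l0 : lift ord0 ord0 = ord_max :> 'I_2 by apply/val_inj.
split.
  rewrite (_ : _ + _ = (x 0 0 + x ord_max ord_max)%:M) //; apply/matrixP => i j.
  by case: (cs i) (cs j) => -> [] ->; rewrite !mxE /= ?r0 ?r1 ?mulr1n ?mulr0n ?subrr // addrC.
rewrite (_ : _ * _ = (x 0 0 * x ord_max ord_max - x 0 ord_max * x ord_max 0)%:M) //.
apply/matrixP => i j; rewrite mxmulE big_ord_recl big_ord1 l0.
case: (cs i) (cs j) => -> [] ->; rewrite !mxE /= ?r0 ?r1 ?mulr1n ?mulr0n ?mulrN //.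
- by rewrite cD addNr.
- by rewrite cD subrr.
- by rewrite cD addrC; congr (_ - _).
Qed.

(** * Subgroups normalized by the transvections *)

Section Transvections.
Variable D : unitRingType.
Hypothesis hdiv : forall x : D, x != 0 -> x \is a GRing.unit.
Variable n : nat.
Hypothesis n2 : (1 < n)%N.
Variable N : set 'M[D]_n.
Hypothesis hN : is_subgroup N.
Hypothesis hE : forall i j a x, i != j -> N x -> N (transv i j a * x * transv i j (- a)).
Hypothesis hnc : ~ (N `<=` center 'M[D]_n).
Implicit Types (i j k l : 'I_n) (a b : D) (x y m w g : 'M[D]_n).

Let N1 : N 1. Proof. by case: hN. Qed.
Let NM x y : N x -> N y -> N (x * y). Proof. by case: hN => _ _ H _; apply: H. Qed.
Let Ninv x : N x -> exists2 y, N y & inverses x y.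
Proof.
move=> Nx; case: hN => H _ _ K; have [y xy] := H _ Nx; exists y => //.
exact: K xy.
Qed.

Lemma inverses_uniq x y z : inverses x y -> inverses x z -> y = z.
Proof. by move=> [xy yx] [xz zx]; rewrite -[y]mulr1 -xz mulrA yx mul1r. Qed.

Definition normalizes g := exists2 g', inverses g g' & forall x, N x -> N (g * x * g').

Lemma normalizesM g h : normalizes g -> normalizes h -> normalizes (g * h).
Proof.
move=> [g' [gg' g'g] Hg] [h' [hh' h'h] Hh]; exists (h' * g').
  split; first by rewrite mulrA -[g * h * h']mulrA hh' mulr1.
  by rewrite mulrA -[h' * g' * g]mulrA g'g mulr1.
by move=> x Nx; have := Hg _ (Hh _ Nx); rewrite !mulrA.
Qed.

Lemma normalizes_transv i j a : i != j -> normalizes (transv i j a).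
Proof. by move=> ij; exists (transv i j (- a)); [apply: transv_inverses|move=> x; apply: hE]. Qed.

Lemma normalizes_mem x : N x -> normalizes x.
Proof.
move=> Nx; have [y Ny xy] := Ninv Nx; exists y => // z Nz.
by apply: NM => //; apply: NM.
Qed.

Lemma mxaddE x y i j : (x + y) i j = x i j + y i j. Proof. by rewrite mxE. Qed.
Lemma mxoppE x i j : (- x) i j = - x i j. Proof. by rewrite mxE. Qed.
Lemma mx1E i j : (1 : 'M[D]_n) i j = (i == j)%:R. Proof. by rewrite mxE. Qed.

(** Conjugation by [1 + a e_ij] gives a diagonal matrix [x] the entry
[a x_jj - x_ii a] at [(i, j)]; if it vanishes for all [a], [i] and [j], then [x]
is a central scalar. *)
Lemma exists_offdiag : exists x i k, [/\ N x, i != k & x i k != 0].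
Proof.
apply: contrapT => H; apply: hnc => x Nx y.
have diag z : N z -> forall i k, i != k -> z i k = 0.
  move=> Nz i k ik; apply/eqP/contraT => nz; by case: H; exists z, i, k.
have key i j a : i != j -> a * x j j = x i i * a.
  move=> ij; have := diag _ (hE a ij Nx) i j ij.
  rewrite /transv munitN mulrBr mulr1 mulrDl mul1r.
  rewrite !(mxaddE, mxoppE) munit_mulr !munit_mull !eqxx !mxaddE !munit_mull eqxx.
  rewrite (diag _ Nx i j) // (diag _ Nx j i) 1?eq_sym // mulr0 addr0 add0r => /eqP.
  by rewrite subr_eq0 => /eqP.
apply/matrixP => i j; rewrite !mxmulE.
rewrite (bigD1 i) //= big1 => [|k ki]; last by rewrite (diag _ Nx) ?mul0r // eq_sym.
rewrite (bigD1 j) //= big1 => [|k kj]; last by rewrite (diag _ Nx) ?mulr0.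
rewrite !addr0; have [->|ij] := eqVneq i j; last by rewrite -(key _ _ _ ij).
have [k jk] : exists k, j != k.
  by have [j0|j0] := eqVneq (j : nat) 0%N;
    [exists (Ordinal n2); rewrite -val_eqE /= j0 | exists (Ordinal (ltnW n2))].
by rewrite -(key j k _ jk); have := key j k 1 jk; rewrite mul1r mulr1 => ->.
Qed.

Lemma normalizes_column i (c : 'I_n -> D) (s : seq 'I_n) : i \notin s ->
  normalizes (1 + \sum_(l <- s) munit l i (c l)).
Proof.
elim: s => [|l s IH]; first by rewrite big_nil addr0 => _; apply: normalizes_mem.
rewrite in_cons negb_or big_cons => /andP[il si].
have -> : 1 + (munit l i (c l) + \sum_(j <- s) munit j i (c j)) =
    transv l i (c l) * (1 + \sum_(j <- s) munit j i (c j)).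
  have Z : munit l i (c l) * \sum_(j <- s) munit j i (c j) = 0.
    rewrite mulr_sumr big1_seq // => j /= js; rewrite munitM; case: eqP => // ij.
    by rewrite ij js in si.
  by rewrite /transv mulrDl mul1r [munit l i _ * _]mulrDr mulr1 Z addr0 [munit l i _ + _]addrC addrA.
by apply: normalizesM; [apply: normalizes_transv; rewrite eq_sym|apply: IH].
Qed.

(** The matrix [x] maps the line of the [k]-th basis vector of the right vector
space [D^n] to the line of the [i]-th. *)
Definition col_unit x k i := exists2 a : D, a != 0 & forall l, x l k = if l == i then a else 0.

Lemma col_unit_mul g x k i j : col_unit x k i -> col_unit g i j -> col_unit (g * x) k j.
Proof.
move=> [a a0 hx] [b b0 hg]; exists (b * a); first exact: div_mulf_neq0.
move=> l; rewrite mxmulE (bigD1 i) //= big1 => [|m mi]; last by rewrite hx (negPf mi) mulr0.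
by rewrite addr0 hx eqxx hg; case: eqP; rewrite ?mul0r.
Qed.

Lemma col_unit_inv x y k i : inverses x y -> col_unit x k i -> col_unit y i k.
Proof.
move=> [xy yx] [a a0 hx]; exists a^-1; first exact: div_invr_neq0.
move=> l; have /matrixP/(_ l k) := yx.
rewrite mxmulE (bigD1 i) //= big1 => [|m mi]; last by rewrite hx (negPf mi) mulr0.
rewrite addr0 hx eqxx mx1E => E; apply: (div_mulIf hdiv a0); rewrite E.
by case: eqP; rewrite ?mulVr ?hdiv ?mul0r.
Qed.

(** Let the [k]-th column of [x] be nonzero in a row [i <> k].  Conjugate by the
column operations that clear the other rows with the help of row [i]: their
inverses fix the [k]-th basis vector, so the new [k]-th column is supported in
row [i]. *)
Lemma exists_col_unit : exists k, exists2 i, i != k & exists2 x, N x & col_unit x k i.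
Proof.
have [x [i [k [Nx ik x0]]]] := exists_offdiag; exists k, i => //.
pose s := [seq l <- enum 'I_n | l != i].
pose c l := - x l k * (x i k)^-1.
have si : i \notin s by rewrite mem_filter eqxx.
pose w c' : 'M[D]_n := \sum_(l <- s) munit l i (c' l : D).
have wE c' p q : w c' p q = if (p != i) && (q == i) then c' p else 0.
  rewrite /w summxE; case: (boolP (p != i)) => pi /=.
    have ps : p \in s by rewrite mem_filter pi mem_enum.
    have us : uniq s by rewrite filter_uniq // enum_uniq.
    rewrite (bigD1_seq p ps us) /=.
    rewrite munitE eqxx /= big1 ?addr0 // => l lp.
    by rewrite munitE eq_sym (negPf lp).
  rewrite big1_seq // => l /=; rewrite mem_filter => /andP[li _].
  by move: pi; rewrite negbK munitE => /eqP ->; rewrite eq_sym (negPf li).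
have [g' [gg' g'g] Hg] := normalizes_column c si.
rewrite -/(w c) in gg' g'g Hg; set g := 1 + w c in gg' g'g Hg.
exists (g * x * g'); first exact: Hg.
have g'k : g' = 1 - w c.
  apply: (@inverses_uniq g) => //; split.
  - rewrite /g mulrDl mul1r mulrBr mulr1.
    rewrite (_ : w c * w c = 0) ?subr0 ?subrK //.
    apply/matrixP => p q; rewrite mxmulE big1 ?mxE // => l _; rewrite !wE.
    by case: (eqVneq l i) => [->|]; rewrite ?andbF ?eqxx ?mulr0 ?mul0r.
  - rewrite /g mulrBl mul1r mulrDr mulr1 (_ : w c * w c = 0) ?addr0 ?addrK //.
    apply/matrixP => p q; rewrite mxmulE big1 ?mxE // => l _; rewrite !wE.
    by case: (eqVneq l i) => [->|]; rewrite ?andbF ?eqxx ?mulr0 ?mul0r.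
exists (x i k) => // l.
have ki : k == i = false by rewrite eq_sym (negPf ik).
rewrite mxmulE (bigD1 k) //= big1 => [|m mk].
  rewrite addr0 g'k mxaddE mxoppE mx1E eqxx wE ki andbF subr0 mulr1.
  rewrite /g mulrDl mul1r mxaddE mxmulE (bigD1 i) //= big1 => [|m mi].
    rewrite addr0 wE eqxx andbT; case: eqP => [->|_] /=; first by rewrite mul0r addr0.
    by rewrite /c mulrVK ?hdiv // subrr.
  by rewrite wE (negPf mi) andbF mul0r.
by rewrite g'k mxaddE mxoppE mx1E (negPf mk) wE ki andbF subr0 mulr0.
Qed.

Lemma transv_mull i j a x k l :
  (transv i j a * x) k l = x k l + (if k == i then a * x j l else 0).
Proof. by rewrite /transv mulrDl mul1r mxaddE munit_mull. Qed.

Lemma transvE i j a k l :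
  (transv i j a) k l = (k == l)%:R + (if (k == i) && (l == j) then a else 0).
Proof. by rewrite /transv mxaddE mx1E munitE. Qed.

(** For [i] different from [k] and [i0], conjugate by a product of transvections
that maps the basis vector [i0] to the basis vector [i] and fixes the [k]-th. *)
Lemma all_col_units : exists k, forall i, exists2 x, N x & col_unit x k i.
Proof.
have [k [i0 ik [x Nx hx]]] := exists_col_unit; exists k => i.
have [->|ik'] := eqVneq i k.
  by exists 1 => //; exists 1 => [|l]; rewrite ?oner_neq0 // mx1E; case: eqP.
have [->|ii0] := eqVneq i i0; first by exists x.
have i0i : i0 != i by rewrite eq_sym.
pose h : 'M[D]_n := transv i0 i (- 1) * transv i i0 1.
have hE' p q : h p q = (p == q)%:R + (if (p == i) && (q == i0) then 1 else 0) +
    (if p == i0 then - ((i == q)%:R + (if q == i0 then 1 else 0)) else 0).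
  by rewrite /h transv_mull !transvE eqxx mulN1r.
have hi : col_unit h i0 i.
  exists 1; rewrite ?oner_neq0 // => p; rewrite hE' eqxx andbT (negPf ii0) add0r.
  case: (eqVneq p i) => [->|pi]; first by rewrite (negPf ii0) addr0 add0r.
  by case: eqP => _; rewrite ?subrr ?addr0 // subrr.
have hk : col_unit h k k.
  exists 1; rewrite ?oner_neq0 // => p; rewrite hE'.
  rewrite [k == i0]eq_sym (negPf ik) andbF (negPf ik') !addr0 oppr0 if_same addr0.
  by case: eqP.
have [h' hh' Hh] : normalizes h by apply: normalizesM; apply: normalizes_transv.
exists (h * x * h'); first exact: Hh.
apply: col_unit_mul (col_unit_inv hh' hk) _.
exact: col_unit_mul hx hi.
Qed.

Section Iwasawa.
Variable k : 'I_n.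
Hypothesis hk : forall i, exists2 x, N x & col_unit x k i.

(** The matrices [1 + w] with [w] of this kind form the abelian unipotent
radical of the stabilizer of the [k]-th basis line. *)
Definition row_nilpotent w := forall p q, (p != k) || (q == k) -> w p q = 0.

Lemma row_nilpotent_mul w w' : row_nilpotent w -> row_nilpotent w' -> w * w' = 0.
Proof.
move=> hw hw'; apply/matrixP => p q; rewrite mxmulE big1 ?mxE // => l _.
by have [->|lk] := eqVneq l k; [rewrite hw ?eqxx ?orbT ?mul0r|rewrite hw' ?lk ?mulr0].
Qed.

(** These are the products of [N] with the part of the abelian group of the
[1 + w] that normalizes [N]; modulo [N] they commute. *)
Definition Iwasawa_product x := exists m w,
  [/\ N m, row_nilpotent w, normalizes (1 + w) & x = m * (1 + w)].

Lemma row_nilpotent_add w w' : row_nilpotent w -> row_nilpotent w' ->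
  (1 + w) * (1 + w') = 1 + (w + w').
Proof.
by move=> hw hw'; rewrite mulrDl mul1r mulrDr mulr1 row_nilpotent_mul // addr0 -addrA [w' + w]addrC.
Qed.

Lemma normalizes_shift u m : normalizes u -> N m -> exists2 m', N m' & u * m = m' * u.
Proof.
move=> [u' [uu' u'u] hu] Nm; exists (u * m * u'); first exact: hu.
by rewrite -[_ * u]mulrA u'u mulr1.
Qed.

Lemma Iwasawa_mul x y : Iwasawa_product x -> Iwasawa_product y -> exists m w, [/\ N m, row_nilpotent w,
  normalizes (1 + w) & x * y = m * (1 + w)] /\ exists2 m', N m' & y * x = m' * (1 + w).
Proof.
move=> [m [w [Nm hw nw ->]]] [m' [w' [Nm' hw' nw' ->]]].
have [m1 Nm1 E1] := normalizes_shift nw Nm'; have [m2 Nm2 E2] := normalizes_shift nw' Nm.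
have rw : row_nilpotent (w + w') by move=> p q h; rewrite mxaddE hw // hw' // addr0.
exists (m * m1), (w + w'); split.
  split=> //; first exact: NM.
    by rewrite -row_nilpotent_add //; apply: normalizesM.
  by rewrite -row_nilpotent_add // -!mulrA; congr (_ * _); rewrite !mulrA E1.
exists (m' * m2); first exact: NM.
by rewrite [w + w']addrC -row_nilpotent_add // -!mulrA; congr (_ * _); rewrite !mulrA E2.
Qed.

Lemma IwasawaM x y : Iwasawa_product x -> Iwasawa_product y -> Iwasawa_product (x * y).
Proof. by move=> hx hy; have [m [w [h _]]] := Iwasawa_mul hx hy; exists m, w. Qed.

Lemma Iwasawa_commutator x y z : Iwasawa_product x -> Iwasawa_product y -> x * y = z * (y * x) -> N z.
Proof.
move=> hx hy E; have [m [w [[Nm hw [u [wu _] _] Exy] [m' Nm' Eyx]]]] := Iwasawa_mul hx hy.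
have [m'' Nm'' [m1 _]] := Ninv Nm'.
have : z * m' = m by rewrite -[z * m']mulr1 -wu mulrA -[z * m' * _]mulrA -Eyx -E Exy -mulrA wu mulr1.
by move=> Ez; rewrite -[z]mulr1 -m1 mulrA Ez; apply: NM.
Qed.

(** Some [y] in [N] maps the [k]-th basis line to the [i]-th, so [y^-1] conjugates
[1 + a e_ij] into the abelian group attached to [k]; undoing the conjugation
changes an element only by a factor in [N]. *)
Lemma Iwasawa_transv i j a : i != j -> Iwasawa_product (transv i j a).
Proof.
move=> ij; have [y Ny hy] := hk i; have [y' Ny' yy'] := Ninv Ny.
have hy' := col_unit_inv yy' hy; have [y1 y2] := yy'.
pose w := y' * munit i j a * y.
have Eu : 1 + w = y' * transv i j a * y by rewrite /transv mulrDr mulrDl mulr1 y2.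
have nu : normalizes (1 + w).
  rewrite Eu; apply: normalizesM (normalizes_mem Ny); apply: normalizesM.
    exact: normalizes_mem.
  exact: normalizes_transv.
have [m Nm Em] := normalizes_shift nu Ny'.
exists (y * m), w; split=> //; first exact: NM.
  have [b b0 hb] := hy'; have [c c0 hc] := hy.
  move=> p q pq; rewrite /w -mulrA mxmulE (bigD1 i) //= big1 => [|l li].
    rewrite munit_mull eqxx addr0 hb; case: (eqVneq p k) pq => [_ /= /eqP ->|]; last by rewrite mul0r.
    by rewrite hc eq_sym (negPf ij) !mulr0.
  by rewrite munit_mull (negPf li) mulr0.
by rewrite -mulrA -Em Eu !mulrA y1 mul1r -mulrA y1 mulr1.
Qed.

(** The diagonal matrix [d = diag (c, c^-1)] is a product of four transvections,
and its commutator with [1 + b e_ij] is [1 + (c^2 - 1) b e_ij]. *)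
Lemma transv_in c i j a : (forall b, c * b = b * c) -> c != 0 -> c * c != 1 -> i != j ->
  N (transv i j a).
Proof.
move=> cc c0 c1 ij.
have ji : j != i by rewrite eq_sym.
pose d : 'M[D]_n := \matrix_(p, q) if p == q then if p == i then c else if p == j then c^-1 else 1 else 0.
have dM x p q : (d * x) p q = (if p == i then c else if p == j then c^-1 else 1) * x p q.
  rewrite mxmulE (bigD1 p) //= mxE eqxx big1 ?addr0 // => l lp.
  by rewrite mxE eq_sym (negPf lp) mul0r.
have Ed : d * transv i j c^-1 = transv j i (c^-1 - 1) * (transv i j 1 * transv j i (c - 1)).
  apply/matrixP => p q; rewrite dM !transv_mull !transvE.
  have cK : c * c^-1 = 1 by rewrite divrr ?hdiv.
  have Kc : c^-1 * c = 1 by rewrite mulVr ?hdiv.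
  case: (eqVneq p i) => [->|pi].
    rewrite !eqxx (negPf ij) /= [i == q]eq_sym [j == q]eq_sym.
    case: (eqVneq q i) => [->|qi]; first by rewrite (negPf ij) !(addr0, mulr1, mul1r, add0r) addrC subrK.
    by case: eqP => _; rewrite !(addr0, add0r, mulr1, mulr0, cK).
  case: (eqVneq p j) => [->|pj].
    rewrite !eqxx (negPf ij) /= [i == q]eq_sym [j == q]eq_sym.
    case: (eqVneq q i) => [->|qi].
      rewrite (negPf ij) !(addr0, mulr1, mul1r, add0r, mulr0) [1 + _]addrC subrK mulrBl Kc mul1r.
      by rewrite addrA subrK subrr.
    by case: eqP => _; rewrite !(addr0, add0r, mulr1, mulr0, mul1r) // addrC subrK.
  by rewrite !addr0 mul1r.
have Id : Iwasawa_product d.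
  have -> : d = transv j i (c^-1 - 1) * (transv i j 1 * transv j i (c - 1)) * transv i j (- c^-1).
    by rewrite -Ed -mulrA transv_mul // subrr transv0 mulr1.
  by do ?[apply: IwasawaM]; apply: Iwasawa_transv.
have c2 : c * c - 1 != 0 by rewrite subr_eq0.
pose b := (c * c - 1)^-1 * a.
apply: (Iwasawa_commutator Id (Iwasawa_transv b ij)).
rewrite mulrA transv_mul // (_ : a + b = c * c * b); last first.
  by rewrite -[a](mulVKr (hdiv c2)) -/b mulrBl mul1r subrK.
clearbody b; apply/matrixP => p q; rewrite dM transv_mull !transvE.
case: (eqVneq p i) => [->|pi]; rewrite /= ?addr0.
  rewrite !mxE [j == i]eq_sym (negPf ij) eqxx eq_sym.
  rewrite mulrDr [j == q]eq_sym; congr (_ + _).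
    by case: eqP => _; rewrite ?mulr1 ?mulr0.
  case: eqP => _; rewrite ?mulr0 //.
  by rewrite eqxx -[c * c * b]mulrA [in RHS](cc b) mulrA mulrK ?hdiv.
by rewrite mxE (negPf pi); case: (p == q); rewrite ?mulr1 ?mulr0.
Qed.
End Iwasawa.
End Transvections.

(** * Proof of the theorem *)

Section Final.
Variables (F : fieldType) (D : unitAlgType F).
Hypothesis hD : division_ring_with_center D.
Let hdiv : forall x : D, x != 0 -> x \is a GRing.unit := hD.1.

Lemma exists_square_neq1 : (exists f : 'I_4 -> F, injective f) ->
  exists c : F, [/\ c != 0, c != 1 & c * c != 1].
Proof.
move=> [f finj]; apply: contrapT => H.
have sub : {subset codom f <= [:: 0; 1; - 1]}.
  move=> c _; apply/negP => /negP; rewrite !inE !negb_or => /and3P[c0 c1 cN].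
  by apply: H; exists c; split=> //; rewrite -expr2 sqrf_eq1 negb_or c1.
have u : uniq (codom f) by apply/injectiveP.
by have := uniq_leq_size u sub; rewrite size_codom card_ord.
Qed.

Lemma subnormal_transv n r (G : set 'M[D]_n) (c : F) : (1 < n)%N -> c != 0 -> c * c != 1 ->
  subnormal_depth r G -> ~ (G `<=` center 'M[D]_n) ->
  forall i j a, i != j -> G (transv i j a).
Proof.
move=> n2 c0 c1; elim: r G => [|r IH] G.
  by move=> -> _ i j a ij; exists (transv i j (- a)); apply: transv_inverses.
move=> [H [snH sgG GH]] nG i j a ij.
have HE : forall i j a, i != j -> H (transv i j a).
  by apply: IH => // HZ; apply: nG => x Gx; apply: HZ; apply: GH.1.
have hE p q b x : p != q -> G x -> G (transv p q b * x * transv p q (- b)).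
  by move=> pq Gx; apply: GH.2 => //; [apply: HE|apply: transv_inverses].
have [k hk] := all_col_units hdiv n2 sgG hE nG.
apply: (transv_in hdiv sgG hE hk (c := c%:A)) => //.
- by move=> b; rewrite -scalerAl -scalerAr mul1r mulr1.
- by rewrite scaler_eq0 oner_eq0 orbF.
- rewrite -scalerAl mul1r scalerA -subr_eq0 -[X in _ - X]scale1r -scalerBl.
  by rewrite scaler_eq0 oner_eq0 orbF subr_eq0.
Qed.

Section Scalars.
Variable n : nat.
Let SM := @scalar_matrices F D n.

Lemma scalar_matricesB x y : SM x -> SM y -> SM (x - y).
Proof.
by move=> [a _ <-] [b _ <-]; exists (a - b) => //; rewrite scalerBl raddfB.
Qed.

Lemma scalar_matricesM x y : SM x -> SM y -> SM (x * y).
Proof.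
move=> [a _ <-] [b _ <-]; exists (a * b) => //.
by rewrite -[RHS]scalar_mxM -scalerAl mul1r scalerA.
Qed.

Lemma scalar_matrices1 : SM 1.
Proof. by exists 1 => //; rewrite scale1r. Qed.

Lemma scalar_matrices_center x : SM x -> center 'M[D]_n x.
Proof.
move=> [a _ <-] y; apply/matrixP => i j; rewrite mx_mul_scalarE scalar_mx_mulE.
by rewrite -scalerAl -scalerAr mul1r mulr1.
Qed.

Lemma scalar_mx_munit (a b : D) i j : a%:M * munit i j b = munit i j (a * b) :> 'M[D]_n.
Proof.
apply/matrixP => p q; rewrite scalar_mx_mulE !munitE.
by case: ifP => _ //; rewrite mulr0.
Qed.

End Scalars.

Section Degree.
Variables (n : nat) (star : 'M[D]_n -> 'M[D]_n) (G : set 'M[D]_n).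
Hypothesis hstar : is_involution star.
Hypothesis hfirst : first_kind star.
Hypothesis hF : exists f : 'I_4 -> F, injective f.
Hypothesis hG : is_subnormal G (unit_group 'M[D]_n).
Hypothesis hGnc : ~ (G `<=` center 'M[D]_n).

(** For norms, put [b a] with [b] in [F] for [a]: the scalar
[b T + b^2 P], where [T] is the trace and [P] the norm of [a e_ij], is known for
[b = 1] and [b = c], and these two values determine [T]. *)
Lemma transv_traces : (1 < n)%N ->
  traces star G `<=` scalar_matrices D n \/ norms star G `<=` scalar_matrices D n ->
  forall i j a, i != j -> scalar_matrices D n (munit i j a + star (munit i j a)).
Proof.
move=> n2 hTN i j a ij; have [c [c0 c1 c2]] := exists_square_neq1 hF.
have [r snG] := subnormal_depthP hG.
have Gt b : G (transv i j b) by apply: (subnormal_transv n2 c0 c2 snG).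
have S1 := scalar_matrices1 n.
have st b : star (transv i j b) = 1 + star (munit i j b) by rewrite (starD hstar) (star1 hstar).
case: hTN => [hT|hN].
  have : scalar_matrices D n (transv i j a + star (transv i j a)) by apply: hT; exists (transv i j a).
  move=> h; have -> : munit i j a + star (munit i j a) = transv i j a + star (transv i j a) - 1 - 1.
    by rewrite st /transv addrACA -[RHS]addrA -opprD [X in _ = X - _]addrC addrK.
  by do 2?[apply: scalar_matricesB].
set t := munit i j a + _; pose p := munit i j a * star (munit i j a).
have norm (b : F) : scalar_matrices D n ((b%:A)%:M * (t + (b%:A)%:M * p)).
  have : scalar_matrices D n (transv i j (b%:A * a) * star (transv i j (b%:A * a))).
    by apply: hN; exists (transv i j (b%:A * a)).
  have Sb : scalar_matrices D n (b%:A)%:M by exists b.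
  have cb := scalar_matrices_center Sb.
  rewrite st /transv mulrDr mulr1 mulrDl mul1r -scalar_mx_munit (starM hstar) (hfirst cb).
  rewrite -addrA => /scalar_matricesB/(_ S1); rewrite [1 + _]addrC addrK.
  suff -> : (b%:A)%:M * munit i j a + (star (munit i j a) * (b%:A)%:M +
    (b%:A)%:M * munit i j a * (star (munit i j a) * (b%:A)%:M)) = (b%:A)%:M * (t + (b%:A)%:M * p) by [].
  rewrite /t /p !mulrDr -addrA; congr (_ + _); rewrite cb; congr (_ + _).
    by rewrite cb.
  rewrite [RHS]cb [X in _ = X * _]cb -!mulrA; congr (_ * _).
  by rewrite cb -mulrA.
have S2 (b : F) : scalar_matrices D n (b%:A)%:M by exists b.
clearbody t p.
have E : (c%:A)%:M * t - (c%:A)%:M * ((c%:A)%:M * t) =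
    (c%:A)%:M * (t + (c%:A)%:M * p) - (c%:A)%:M * ((c%:A)%:M * ((1%:A)%:M * (t + (1%:A)%:M * p))).
  have -> : (1%:A)%:M = 1 :> 'M[D]_n by rewrite scale1r.
  by rewrite !mul1r !mulrDr opprD addrACA subrr addr0.
have h : scalar_matrices D n ((c%:A)%:M * t - (c%:A)%:M * ((c%:A)%:M * t)).
  by rewrite E; apply: scalar_matricesB => //; do 2?[apply: scalar_matricesM].
have d0 : c - c * c != 0 by rewrite -[X in X - _]mulr1 -mulrBr mulf_neq0 // subr_eq0 eq_sym.
have -> : t = ((c - c * c)^-1%:A)%:M * ((c%:A)%:M * t - (c%:A)%:M * ((c%:A)%:M * t)).
  have scM (x y : F) : (x%:A)%:M * (y%:A)%:M = ((x * y)%:A)%:M :> 'M[D]_n.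
    by rewrite -[LHS]scalar_mxM -scalerAl mul1r scalerA.
  rewrite mulrA scM -mulrBl -raddfB -scalerBl mulrA scM mulVf //.
  by rewrite scale1r mul1r.
exact: scalar_matricesM.
Qed.

Lemma degree_ge2_case : (1 < n)%N ->
  traces star G `<=` scalar_matrices D n \/ norms star G `<=` scalar_matrices D n ->
  (traces star setT `<=` scalar_matrices D n /\ norms star setT `<=` scalar_matrices D n) /\
  [/\ n = 2%N, (forall x : D, exists a : F, x = a%:A) & is_ordinary_symplectic star].
Proof.
move=> n2 hTN.
have H := ordinary_symplectic hD hstar n2 (transv_traces n2 hTN).
split=> //; have [e2 hb hs] := H.
by split=> _ [x _ <-]; have [] := symplectic_trace_norm e2 hb hs x.
Qed.

Lemma noncentral_mem : exists2 x, G x & ~ center 'M[D]_n x.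
Proof.
apply: contrapT => H; apply: hGnc => x Gx; apply: contrapT => nx.
by apply: H; exists x.
Qed.
End Degree.

Section DegreeOne.
Variables (star : 'M[D]_1 -> 'M[D]_1).
Hypothesis hstar : is_involution star.
Hypothesis hfirst : first_kind star.

Definition corner_star (x : D) : D := star x%:M 0 0.

Lemma corner_starE x : star x%:M = (corner_star x)%:M.
Proof. exact: mx11_scalar. Qed.

Lemma scalar_mx1_inj (x y : D) : x%:M = y%:M :> 'M[D]_1 -> x = y.
Proof. by move=> /matrixP/(_ 0 0); rewrite !mxE eqxx. Qed.

Lemma scalar_mx1M (x y : D) : (x * y)%:M = x%:M * y%:M :> 'M[D]_1.
Proof. exact: scalar_mxM. Qed.

Lemma corner_star_involution : is_involution corner_star.
Proof.
split=> [x y|x y|x]; apply: scalar_mx1_inj; rewrite -!corner_starE.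
- by rewrite raddfD (starD hstar) !corner_starE raddfD.
- by rewrite scalar_mx1M (starM hstar) !corner_starE scalar_mx1M.
- by rewrite (starK hstar).
Qed.

Lemma center_mx1 (x : D) : center 'M[D]_1 x%:M <-> center D x.
Proof.
split=> [h y|h y]; first by apply: scalar_mx1_inj; rewrite !scalar_mx1M h.
by rewrite [y]mx11_scalar -!scalar_mx1M h.
Qed.

Lemma corner_star_first_kind : first_kind corner_star.
Proof.
by move=> z cz; apply: scalar_mx1_inj; rewrite -corner_starE hfirst //; apply/center_mx1.
Qed.

Lemma scalar_matrices_mx1 (x : D) : scalar_matrices D 1 x%:M <-> center D x.
Proof.
rewrite hD.2; split=> [[a _ /scalar_mx1_inj <-]|[a _ <-]]; by exists a.
Qed.

Lemma inverses_mx1 (x y : D) : inverses (x%:M : 'M[D]_1) y%:M <-> inverses x y.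
Proof.
rewrite /inverses -!scalar_mx1M; split=> [[E1 E2]|[-> ->] //].
by split; apply: scalar_mx1_inj.
Qed.

Definition scalar_part (G : set 'M[D]_1) : set D := [set x | G x%:M].

Lemma scalar_part_subgroup G : is_subgroup G -> is_subgroup (scalar_part G).
Proof.
move=> [GU G1 GM GV]; split.
- move=> x /GU[y]; rewrite [y]mx11_scalar => /inverses_mx1 xy.
  by exists (y 0 0).
- exact: G1.
- by move=> x y Gx Gy; rewrite /scalar_part /= scalar_mx1M; apply: GM.
- by move=> x y Gx /inverses_mx1 xy; apply: GV xy.
Qed.

Lemma scalar_part_subnormal r G : subnormal_depth r G -> subnormal_depth r (scalar_part G).
Proof.
elim: r G => [|r IH] G /=.
  move=> ->; apply/seteqP; split=> x [y].
    by rewrite [y]mx11_scalar => /inverses_mx1 xy; exists (y 0 0).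
  by move=> /inverses_mx1 xy; exists y%:M.
move=> [H [snH sgG [GH nGH]]]; exists (scalar_part H); split.
- exact: IH.
- exact: scalar_part_subgroup.
split=> [x|k k' h Hk /inverses_mx1 kk' Gh]; first exact: GH.
by rewrite /scalar_part /= !scalar_mx1M; apply: nGH.
Qed.

Lemma degree_one_case (G : set 'M[D]_1) :
  is_subnormal G (unit_group 'M[D]_1) -> ~ (G `<=` center 'M[D]_1) ->
  traces star G `<=` scalar_matrices D 1 \/ norms star G `<=` scalar_matrices D 1 ->
  (traces star setT `<=` scalar_matrices D 1 /\ norms star setT `<=` scalar_matrices D 1) /\
  quaternion_division_algebra D.
Proof.
move=> /subnormal_depthP[r /scalar_part_subnormal snG] /noncentral_mem[A GA nA] hTN.
pose a := A 0 0; have EA : A = a%:M by apply: mx11_scalar.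
have Ga : scalar_part G a by rewrite /scalar_part /= -EA.
have na : ~ center D a by move=> ca; apply: nA; rewrite EA; apply/center_mx1.
have hs := corner_star_involution; have hf := corner_star_first_kind.
have NG g : scalar_part G g -> center D (g * corner_star g).
  case: hTN => [hT|hN] Gg.
    apply: (traces_norms_subnormal hdiv hs snG Ga na) Gg => x Gx.
    apply/scalar_matrices_mx1; rewrite (_ : _%:M = x%:M + star x%:M); last by rewrite corner_starE raddfD.
    by apply: hT; exists x%:M.
  apply/scalar_matrices_mx1; rewrite scalar_mx1M -corner_starE; apply: hN.
  by exists g%:M.
have N := norms_subnormal hdiv hs snG Ga na NG.
have T := norms_traces hdiv hs N.
split; last exact: (trace_norm_quaternion hD hs hf T N na).
split=> _ [x _ <-]; rewrite [x]mx11_scalar corner_starE.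
  rewrite (_ : _ + _ = (x 0 0 + corner_star (x 0 0))%:M); last by rewrite raddfD.
  by apply/scalar_matrices_mx1.
by rewrite -scalar_mx1M; apply/scalar_matrices_mx1.
Qed.
End DegreeOne.
End Final.

Theorem theorem4p9 (F : fieldType) (D : unitAlgType F) (n : nat)
    (star : 'M[D]_n -> 'M[D]_n) (G : set 'M[D]_n)
    (hD : division_ring_with_center D)
    (hF : exists f : 'I_4 -> F, injective f)
    (hn : (0 < n)%N)
    (hstar : is_involution star)
    (hfirst : first_kind star)
    (hG : is_subnormal G (unit_group 'M[D]_n))
    (hGnc : ~ (G `<=` center 'M[D]_n)) :
  [<-> traces star G `<=` scalar_matrices D n;
       traces star setT `<=` scalar_matrices D n;
       norms star setT `<=` scalar_matrices D n;
       norms star G `<=` scalar_matrices D n] /\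
  ([\/ traces star G `<=` scalar_matrices D n,
       traces star setT `<=` scalar_matrices D n,
       norms star setT `<=` scalar_matrices D n
     | norms star G `<=` scalar_matrices D n] ->
   (n = 1%N /\ quaternion_division_algebra D) \/
   [/\ n = 2%N,
       (forall x : D, exists a : F, x = a%:A)
     & is_ordinary_symplectic star]).
Proof.
have key : traces star G `<=` scalar_matrices D n \/ norms star G `<=` scalar_matrices D n ->
  (traces star setT `<=` scalar_matrices D n /\ norms star setT `<=` scalar_matrices D n) /\
  ((n = 1%N /\ quaternion_division_algebra D) \/
   [/\ n = 2%N, (forall x : D, exists a : F, x = a%:A) & is_ordinary_symplectic star]).
  move=> hTN; have [n1|n2] : n = 1%N \/ (1 < n)%N by lia.
    subst n; have [h q] := degree_one_case hD hstar hfirst hG hGnc hTN.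
    by split=> //; left.
  by have [h q] := degree_ge2_case hD hstar hfirst hF hG hGnc n2 hTN; split=> //; right.
have traces_sub : traces star G `<=` traces star setT by move=> _ [x _ <-]; exists x.
have norms_sub : norms star G `<=` norms star setT by move=> _ [x _ <-]; exists x.
split.
  tfae=> h.
  - by have [[]] := key (or_introl h).
  - by have [[_ ]] := key (or_introl (subset_trans traces_sub h)).
  - exact: subset_trans norms_sub h.
  - by have [[hT _] _] := key (or_intror h); apply: subset_trans traces_sub hT.
case=> h; apply: (key _).2.
- by left.
- by left; apply: subset_trans traces_sub h.
- by right; apply: subset_trans norms_sub h.
- by right.
Qed.
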